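(* The following three statements are equivalent. (HC, the hyperplane conjecture) There exists a universal constant $c>0$ such that for every $d\in\mathbb{N}$ and every convex body $K\subset\mathbb{R}^d$ with $\mathrm{vol}_d(K)=1$, there exists an (affine) hyperplane $\mathcal{H}\subset\mathbb{R}^d$ such that $\mathrm{vol}_{d-1}(\mathcal{H}\cap K)\geq c$. ($\Lambda_1$) There exist $\delta\in(0,e^{-1})$ and $r>0$ such that for all $d\in\mathbb{N}$ and all isotropic convex bodies $K\subset\mathbb{R}^d$ of unit volume, $K_\delta\subset B(0,r)$. ($\Lambda_2$) For all $\delta\in(0,e^{-1})$ there exists $r>0$ such that for all $d\in\mathbb{N}$ and all isotropic convex bodies $K\subset\mathbb{R}^d$ of unit volume, $K_\delta\subset B(0,r)$.
   Context: A convex body in $\mathbb{R}^d$ is a compact convex set with non-empty interior. $B(0,r)=\{x\in\mathbb{R}^d:\|x\|_2\leq r\}$ is the closed Euclidean ball. $\mathrm{vol}_d$ denotes $d$-dimensional Lebesgue measure, and $\mathrm{vol}_{d-1}$ denotes $(d-1)$-dimensional Lebesgue measure on a hyperplane. For $\theta\in S^{d-1}$ (the Euclidean unit sphere) and $t\in\mathbb{R}$ let $\mathfrak{H}_{\theta,t}=\{x\in\mathbb{R}^d:\langle x,\theta\rangle\geq t\}$. For a convex body $K\subset\mathbb{R}^d$ and $\delta>0$, the convex floating body inside $K$ is $$K_\delta=\bigcap\{\mathfrak{H}_{\theta,t}:\theta\in S^{d-1},\ t\in\mathbb{R},\ \mathrm{vol}_d(\mathfrak{H}_{\theta,t}\cap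 K)\geq(1-\delta)\,\mathrm{vol}_d(K)\}.$$ A convex body $K\subset\mathbb{R}^d$ is called isotropic if its centroid is at the origin and a random vector $X$ uniformly distributed in $K$ has covariance matrix $\mathrm{cov}(X)=L_K^2 I_d$ for some $L_K>0$, where $I_d$ is the $d\times d$ identity matrix. (This does not by itself require unit volume or $L_K=1$.) *)

(* Defs.v *)
From HB Require Import structures.
From mathcomp Require Import all_boot all_order all_algebra ring.
From mathcomp Require Import all_classical all_reals all_analysis.
From mathcomp Require Import measurable_realfun.

Set Implicit Arguments.
Unset Strict Implicit.
Unset Printing Implicit Defensive.

Import Order.TTheory GRing.Theory Num.Theory.
Import numFieldNormedType.Exports.

Local Open Scope classical_set_scope.
Local Open Scope ring_scope.

(* Borel sigma-algebra of R^d. The library topology on matrices is the one of the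
   sup norm, hence the Euclidean topology. *)
HB.instance Definition _ (R : realType) (d : nat) :=
  @isMeasurable.Build (sigma_display (@open 'rV[R]_d)) 'rV[R]_d <<s open >>
    (@sigma_algebra0 _ setT open) (@sigma_algebraC _ open)
    (@sigma_algebra_bigcup _ setT open).

Section borel_rV.
Context {R : realType}.

Lemma open_measurable_rV d (U : set 'rV[R]_d) : open U -> measurable U.
Proof. exact: sub_sigma_algebra. Qed.

Lemma compact_measurable_rV d (A : set 'rV[R]_d) : compact A -> measurable A.
Proof.
move=> cA; rewrite -(setCK A); apply: measurableC; apply: open_measurable_rV.
apply: closed_openC; apply: compact_closed => //; exact: norm_hausdorff.
Qed.

Lemma measurable_coord d (i : 'I_d) :
  measurable_fun [set: 'rV[R]_d] (fun x => x 0 i : measurableTypeR R).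
Proof.
apply: (measurability _ (RGenOpens.measurableE R)).
move=> _ [_ [a [b ->] <-]]; rewrite setTI; apply: open_measurable_rV.
have /continuousP := @coord_continuous R 1 d 0 i; apply.
exact: interval_open.
Qed.

Definition box d (A : 'I_d -> set R) : set 'rV[R]_d :=
  [set x | forall i, A i (x 0 i)].

Lemma measurable_box d (A : 'I_d -> set (measurableTypeR R)) :
  (forall i, measurable (A i)) -> measurable (box A).
Proof.
move=> mA.
rewrite (_ : box A = \bigcap_i ((fun x => x 0 i) @^-1` A i)); last first.
  by apply/seteqP; split => x /= Ax i; [move=> _|]; exact: Ax.
apply: fin_bigcap_measurable => // i _.
by rewrite -[X in measurable X]setTI; exact: measurable_coord.
Qed.

Lemma open_bigcup_ball_rV d (U : set 'rV[R]_d) : open U ->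
  U = \bigcup_(p in [set p : 'rV[rat]_d * nat |
                      ball (map_mx ratr p.1 : 'rV[R]_d) p.2.+1%:R^-1 `<=` U])
        ball (map_mx ratr p.1 : 'rV[R]_d) p.2.+1%:R^-1.
Proof.
move=> oU; apply/seteqP; split => [x Ux|x [p pU]]; last exact: pU.
have /nbhs_ballP[e /= e0 xeU] : nbhs x U by exact: open_nbhs_nbhs.
pose k := Num.truncn (2 / e).
have k0 : 0 < k.+1%:R^-1 :> R by rewrite invr_gt0.
have ke : k.+1%:R^-1 + k.+1%:R^-1 <= e :> R.
  have h : 2 / e < k.+1%:R by exact: truncnS_gt.
  rewrite -mulr2n -[X in X <= _]mulr_natl ler_pdivrMr ?ltr0n//.
  by rewrite mulrC -ler_pdivrMr// ltW.
have qP i : exists q : rat, ball (x 0 i) k.+1%:R^-1 (ratr q : R).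
  have [|y [bxy [q _ qy]]] := @dense_rat R _ _ (ball_open (x 0 i : R) k.+1%:R^-1).
    by exists (x 0 i); exact: ballxx.
  by exists q; rewrite qy.
pose q : 'rV[rat]_d := \row_i projT1 (cid (qP i)).
have xq : ball x k.+1%:R^-1 (map_mx ratr q : 'rV[R]_d).
  split => // i j; rewrite ord1 !mxE; exact: (projT2 (cid (qP j))).
exists (q, k) => /=; last exact: ball_sym.
move=> y qy; apply: xeU; apply: le_ball ke _ _; exact: ball_triangle qy.
Qed.

Definition cons_rV d (p : measurableTypeR R * 'rV[R]_d) : 'rV[R]_d.+1 :=
  row_mx (p.1 : R)%:M p.2.

Lemma cons_rV0 d (x : R) (v : 'rV[R]_d) : cons_rV (x, v) 0 ord0 = x.
Proof.
have := row_mxEl (x%:M : 'M[R]_1) v 0 0; rewrite [RHS]mxE eqxx mulr1n; apply: etrans.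
apply: (congr1 (fun j : 'I_(1 + d) => row_mx (x%:M : 'M[R]_1) v 0 j)).
exact/val_inj.
Qed.

Lemma cons_rVS d (x : R) (v : 'rV[R]_d) i : cons_rV (x, v) 0 (lift ord0 i) = v 0 i.
Proof.
have <- := row_mxEr (x%:M : 'M[R]_1) v 0 i.
apply: (congr1 (fun j : 'I_(1 + d) => row_mx (x%:M : 'M[R]_1) v 0 j)).
exact/val_inj.
Qed.

Lemma preimage_cons_rV_box d (A : 'I_d.+1 -> set R) :
  @cons_rV d @^-1` box A = A ord0 `*` box (fun i => A (lift ord0 i)).
Proof.
apply/seteqP; split => [[x v] /= Av|[x v] /= [Ax Av] i].
  split => [|i] /=; first by have := Av ord0; rewrite cons_rV0.
  by have := Av (lift ord0 i); rewrite cons_rVS.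
by case: (unliftP ord0 i) => [j|] ->; rewrite ?cons_rVS ?cons_rV0//; exact: Av.
Qed.

Lemma measurable_cons_rV d : measurable_fun setT (@cons_rV d).
Proof.
apply: (@measurability _ _ _ _ _ _ (@open 'rV[R]_d.+1)) => //.
move=> _ [U oU <-]; rewrite setTI (open_bigcup_ball_rV oU) preimage_bigcup.
rewrite bigcup_mkcond; apply: countable_bigcupT_measurable; first exact: countableP.
move=> -[q k].
case: ifPn => // _.
set c := map_mx _ _; set e := _^-1.
rewrite (_ : ball c e = box (fun i => ball (c 0 i) e)).
  rewrite preimage_cons_rV_box; apply: measurableX.
    exact: (open_measurable (ball_open _ _)).
  by apply: measurable_box => i; exact: (open_measurable (ball_open _ _)).
apply/seteqP; split => [x [_ cx] i//|x cx]; split => [|i j].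
  by rewrite invr_gt0.
by rewrite ord1; exact: cx.
Qed.

End borel_rV.

(* Lebesgue measure on the Borel sets of R^d, as an iterated product transported
   along R * R^d' ~ R^(d'+1); on R^0 it is the Dirac mass at the only point. See
   volume_box for its value on boxes, which characterizes it. *)
Fixpoint volume {R : realType} (d : nat) : set 'rV[R]_d -> \bar R :=
  match d with
  | 0 => \d_(0 : 'rV[R]_0)
  | d'.+1 => pushforward (lebesgue_measure \x @volume R d')%E (@cons_rV R d')
  end.
Arguments volume {R d}.

Section volume_measure.
Context {R : realType}.

Local Lemma volume_sigma_finite_measure d :
  exists2 m : {sigma_finite_measure set 'rV[R]_d -> \bar R},
    m = volume :> (set 'rV[R]_d -> \bar R) &
    forall A : 'I_d -> set (measurableTypeR R), (forall i, measurable (A i)) ->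
      m (box A) = (\prod_(i < d) lebesgue_measure (A i))%E.
Proof.
elim: d => [|d [m mE mbox]].
  exists (\d_(0 : 'rV[R]_0)) => // A mA; rewrite big_ord0 /= diracE.
  by rewrite mem_set// => -[].
pose p : {measure set (measurableTypeR R * 'rV[R]_d) -> \bar R} :=
  (lebesgue_measure \x m)%E.
pose mu : set 'rV[R]_d.+1 -> \bar R := pushforward p (@cons_rV R d).
have mpre (A : set 'rV[R]_d.+1) :
    measurable A -> measurable (@cons_rV R d @^-1` A).
  by move=> mA; rewrite -[X in measurable X]setTI; exact: measurable_cons_rV.
have mu0 : mu set0 = 0%E by rewrite /mu /pushforward preimage_set0 measure0.
have mu_ge0 A : (0 <= mu A)%E by exact: (measure_ge0 p).
have mu_sigma : semi_sigma_additive mu.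
  move=> F mF tF mUF; rewrite /mu /pushforward preimage_bigcup.
  apply: measure_semi_sigma_additive.
  - by move=> n; exact: mpre.
  - apply/trivIsetP => /= i j _ _ ij; rewrite -preimage_setI.
    by move/trivIsetP : tF => /(_ _ _ _ _ ij) ->//; rewrite preimage_set0.
  - by rewrite -preimage_bigcup; exact: mpre.
have mubox (A : 'I_d.+1 -> set (measurableTypeR R)) :
    (forall i, measurable (A i)) ->
    mu (box A) = (\prod_(i < d.+1) lebesgue_measure (A i))%E.
  move=> mA; rewrite /mu /pushforward preimage_cons_rV_box.
  have mA' : measurable (box (fun i => A (lift ord0 i))).
    exact: measurable_box.
  apply: etrans (product_measure1E lebesgue_measure m (mA ord0) mA') _.
  by rewrite mbox// big_ord_recl.
pose I (n : nat) : set (measurableTypeR R) := `]- n%:R, n%:R[%classic.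
have mI n : measurable (I n) by exact: measurable_itv.
have mu_sf : sigma_finite setT mu.
  exists (fun n => box (fun=> I n)) => [|n].
    apply/esym/seteqP; split => // x _.
    exists (Num.truncn (\sum_i `|x 0 i|)).+1 => // i.
    rewrite /I /= in_itv/= -ltr_norml.
    apply: le_lt_trans (truncnS_gt _).
    by rewrite (bigD1 i)//= lerDl sumr_ge0.
  split; first exact: measurable_box.
  rewrite mubox// -ge0_fin_numE; last by apply: prode_ge0.
  apply: prode_fin_num => i _; rewrite /I lebesgue_measure_itv.
  by case: ifP.
pose m1 := isMeasure.Build _ _ _ mu mu0 mu_ge0 mu_sigma.
pose M : {measure set 'rV[R]_d.+1 -> \bar R} := HB.pack mu m1.
pose m2 := Measure_isSigmaFinite.Build _ _ _ M mu_sf.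
pose M' : {sigma_finite_measure set 'rV[R]_d.+1 -> \bar R} := HB.pack mu m1 m2.
exists M' => //=.
by rewrite -mE.
Qed.


Let volume0 d : @volume R d set0 = 0%E.
Proof. by have [m <- _] := volume_sigma_finite_measure d; exact: measure0. Qed.

Let volume_ge0 d A : (0 <= @volume R d A)%E.
Proof. by have [m <- _] := volume_sigma_finite_measure d; exact: measure_ge0. Qed.

Let volume_sigma_additive d : semi_sigma_additive (@volume R d).
Proof.
have [m <- _] := volume_sigma_finite_measure d.
exact: measure_semi_sigma_additive.
Qed.

HB.instance Definition _ d := isMeasure.Build _ _ _ (@volume R d)
  (@volume0 d) (@volume_ge0 d) (@volume_sigma_additive d).

Let volume_sigma_finite d : sigma_finite setT (@volume R d).
Proof.
by have [m <- _] := volume_sigma_finite_measure d; exact: sigma_finiteT.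
Qed.

HB.instance Definition _ d := Measure_isSigmaFinite.Build _ _ _ (@volume R d)
  (@volume_sigma_finite d).

Lemma volume_box d (A : 'I_d -> set (measurableTypeR R)) :
  (forall i, measurable (A i)) ->
  volume (box A) = (\prod_(i < d) lebesgue_measure (A i))%E.
Proof. by have [m <- +] := volume_sigma_finite_measure d; exact. Qed.

End volume_measure.

Section euclidean.
Context {R : realType} {d : nat}.
Implicit Types (x y theta : 'rV[R]_d) (t r : R).

Definition dotv x y : R := \sum_i x 0 i * y 0 i.

(* The library norm `|x| on matrices is the sup norm. *)
Definition norm2 x : R := Num.sqrt (dotv x x).

Definition sphere : set 'rV[R]_d := [set theta | norm2 theta = 1].

Definition ball2 x r : set 'rV[R]_d := [set y | norm2 (y - x) <= r].

Definition halfspace theta t : set 'rV[R]_d := [set x | t <= dotv x theta].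

Definition hyperplane theta t : set 'rV[R]_d := [set x | dotv x theta = t].

(* The rows of U form an orthonormal basis of the orthogonal of theta. *)
Definition orthonormal_frame theta (U : 'M[R]_(d.-1, d)) : Prop :=
  U *m U^T = 1%:M /\ forall i, dotv (row i U) theta = 0.

(* (d-1)-dimensional Lebesgue measure on hyperplane theta t, for theta on the
   unit sphere: the image of Lebesgue measure under the isometry
   y |-> t *: theta + y *m U from R^(d-1) onto the hyperplane. The choice of the
   frame U is immaterial since Lebesgue measure is invariant under orthogonal
   maps. *)
Definition hyperplane_volume theta t (A : set 'rV[R]_d) : \bar R :=
  volume [set y : 'rV[R]_d.-1 |
    A (t *: theta + y *m xget 0 [set U | orthonormal_frame theta U])].

End euclidean.
Arguments sphere {R} d.

Lemma orthonormal_frame_ex (R : realType) d (theta : 'rV[R]_d) :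
  sphere d theta -> exists U, orthonormal_frame theta U.
Proof.
case: d theta => [|n] theta th1.
  by exists 0; split; [apply/matrixP => -[]|case].
have thth : theta *m theta^T = 1%:M.
  apply/matrixP => i j; rewrite !ord1 !mxE eqxx/=.
  under eq_bigr do rewrite mxE.
  rewrite -[LHS]sqr_sqrtr; last by apply: sumr_ge0 => k _; rewrite -expr2 sqr_ge0.
  by rewrite [X in X ^+ 2]th1 expr1n.
suff [H [HH rH]] : exists H : 'M[R]_n.+1, H *m H^T = 1%:M /\ row 0 H = theta.
  exists (row' 0 H); split.
    apply/matrixP => i j; have /matrixP/(_ (lift 0 i) (lift 0 j)) := HH.
    rewrite !mxE (inj_eq lift_inj) => <-.
    by apply: eq_bigr => k _; rewrite !mxE.
  move=> i; have /matrixP/(_ (lift 0 i) 0) := HH.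
  rewrite -rH !mxE eq_sym (negbTE (neq_lift _ _)) mulr0n => <-.
  by apply: eq_bigr => k _; rewrite !mxE.
pose e : 'rV[R]_n.+1 := delta_mx 0 0.
have [v vE] : exists v, v = theta - e by exists (theta - e).
have [v0|v0] := eqVneq v 0.
  exists 1%:M; rewrite trmx1 mulmx1; split => //.
  by rewrite rowE mulmx1; apply/esym/eqP; rewrite -subr_eq0 -vE; exact/eqP.
have ee : e *m e^T = 1%:M.
  rewrite trmx_delta mul_delta_mx; apply/matrixP => i j.
  by rewrite !ord1 !mxE !eqxx.
pose a := theta 0 0.
have eth : e *m theta^T = a%:M.
  rewrite -rowE; apply/matrixP => i j; rewrite !ord1 !mxE.
  by rewrite eqxx mulr1n.
have the : theta *m e^T = a%:M.
  by apply: trmx_inj; rewrite trmx_mul trmxK eth tr_scalar_mx.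
have [s sE] : exists s, s = 2 - a *+ 2 by exists (2 - a *+ 2).
have vv : v *m v^T = s%:M.
  rewrite vE linearB/= mulmxBl !mulmxBr thth ee eth the sE.
  rewrite -!raddfB/=; congr (_%:M); rewrite mulr2n opprB; ring.
have s0 : s != 0.
  apply: contra_neq v0 => s0; move: vv; rewrite s0 => /matrixP/(_ 0 0).
  rewrite !mxE mul0rn => /eqP; rewrite psumr_eq0; last first.
    by move=> k _; rewrite [v^T _ _]mxE -expr2 sqr_ge0.
  move=> /allP vk; apply/rowP => k; have := vk k (mem_index_enum _).
  by rewrite [v^T _ _]mxE [RHS]mxE -expr2 sqrf_eq0 => /eqP.
have [P PE] : exists P, P = v^T *m v by exists (v^T *m v).
have PT : P^T = P by rewrite PE trmx_mul trmxK.
have PP : P *m P = s *: P.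
  by rewrite PE mulmxA -(mulmxA v^T) vv mul_mx_scalar -scalemxAl.
exists (1%:M - (2 / s) *: P); split.
  have -> : (1%:M - (2 / s) *: P)^T = 1%:M - (2 / s) *: P.
    by apply/matrixP => i j; rewrite !mxE eq_sym -[in LHS]PT mxE.
  rewrite mulmxBl !mulmxBr !mul1mx mulmx1.
  rewrite -scalemxAl -scalemxAr PP !scalerA.
  rewrite (_ : 2 / s * (2 / s) * s = 2 / s + 2 / s); last by field.
  by rewrite scalerDl opprB addrK subrK.
rewrite rowE mulmxBr mulmx1 -scalemxAr PE mulmxA -/e.
rewrite {1}vE linearB/= mulmxBr eth ee -raddfB/= mul_scalar_mx scalerA.
rewrite (_ : 2 / s * (a - 1) = -1); last first.
  have -> : a - 1 = - (s / 2) by rewrite sE; field.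
  by field.
by rewrite scaleN1r opprK vE addrC subrK.
Qed.

Record convex_body (R : realType) (d : nat) := ConvexBody {
  convex_body_set :> set 'rV[R]_d ;
  convex_body_compact : compact convex_body_set ;
  convex_body_convex :
    convex_set (convex_body_set : set (convex_lmodType 'rV[R]_d)) ;
  convex_body_interior : convex_body_set° !=set0 }.

Section convex_bodies.
Context {R : realType} {d : nat}.
Implicit Type K : convex_body R d.

Lemma measurable_convex_body K : measurable (K : set 'rV[R]_d).
Proof. by apply: compact_measurable_rV; exact: convex_body_compact. Qed.

(* A convex body has positive finite volume, so the default \d_0 of the
   normalization is never used. *)
Definition uniform K : probability 'rV[R]_d R :=
  mnormalize (mrestr volume (measurable_convex_body K)) \d_(0 : 'rV[R]_d).

Definition coord (i : 'I_d) (x : 'rV[R]_d) : R := x 0 i.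

Definition isotropic K : Prop :=
  (forall i, 'E_(uniform K)[coord i] = 0)%E /\
  exists2 L : R, 0 < L &
    forall i j, covariance (uniform K) (coord i) (coord j) =
                (((L ^+ 2)%:M : 'M[R]_d) i j)%:E.

Definition floating_body (delta : R) K : set 'rV[R]_d :=
  \bigcap_(p in [set p : 'rV[R]_d * R | sphere d p.1 /\
     ((1 - delta)%:E * volume K <= volume (halfspace p.1 p.2 `&` K))%E])
    halfspace p.1 p.2.

End convex_bodies.

(* Main.v *)
(* All three statements amount to a uniform bound on the constant L_K of the isotropic
   convex bodies K of unit volume. By Brunn-Minkowski, the density f of the law of
   <X, theta>, that is the function t |-> vol_(d-1)(K /\ {<x, theta> = t}), is log-concave.

   A log-concave probability density satisfies Var <= 256 / f(t)^2 at every t, so one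
   hyperplane section of volume at least c forces L_K <= 16 / c. Then Chebyshev's
   inequality puts K_delta inside the ball of radius L_K / sqrt delta.

   Conversely, let F be the distribution function of f, which is log-concave too, and
   let a be a slope of log F at a point t with F(t) = delta < 1/e. Integrating
   F(x) <= min(1, delta e^(a(x - t))) yields Gruenbaum's inequality
   t <= (1 + ln delta) / a; moreover f must take values of order a delta, so that 1 / a
   is at least of order delta L_K. Hence K_delta contains the ball of radius
   kappa(delta) L_K, and K_delta inside B(0, r) gives L_K <= r / kappa(delta).

   Finally any K of unit volume has an isotropic position, and by a Cholesky
   factorization of its covariance matrix some direction has variance at most the square
   of the isotropic constant of that position; Chebyshev's inequality in this direction
   gives a large section. *)
From mathcomp Require Import all_boot all_order all_fingroup all_algebra ring lra.
From mathcomp Require Import all_classical all_reals all_analysis.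
From mathcomp Require Import measurable_realfun.
Require Import Defs.

Set Implicit Arguments.
Unset Strict Implicit.
Unset Printing Implicit Defensive.

Import Order.TTheory GRing.Theory Num.Theory.
Import numFieldNormedType.Exports.

Local Open Scope classical_set_scope.
Local Open Scope ring_scope.

(** * Linear changes of variables *)

(** Section volumes are defined through an arbitrary orthonormal frame, so Fubini turns them into a
    density only once linear maps are known to scale volume by the determinant; the linear algebra
    on [volume] exists for that purpose and for isotropic positions. Brunn-Minkowski is taken in its
    multiplicative form: it does not involve the dimension, hence passes from slices to bodies by
    induction.

    On the line, identities between moments are arranged so that every integrand is nonnegative.
    This is why barycenter 0 is expressed by saying that [M - u] has mean [M], for a density
    supported in [[-M, M]].

    Constants: a density with value [f t] falls by a factor 4 over the length [s = 8 / f t], whence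
    the variance bound [4 s^2 = 256 / f t ^ 2] and the 16; finding a value of order [a delta] costs
    another 4. So kappa(delta) is [- (1 + ln delta) * (delta / 64)], which is positive because
    [delta < 1/e].

    Cholesky replaces a diagonalization: the isotropic constant of the new position is the geometric
    mean of the diagonal of the triangular factor, so the least diagonal entry is at most that
    constant. *)

Section volume_uniqueness.
Context {R : realType}.

Lemma continuous_measurable_rV d e (f : 'rV[R]_d -> 'rV[R]_e) :
  continuous f -> measurable_fun setT f.
Proof.
move=> cf; apply: (@measurability _ _ _ _ _ _ (@open 'rV[R]_e)) => //.
move=> _ [U oU <-]; rewrite setTI; apply: open_measurable_rV.
by move/continuousP : cf; apply.
Qed.

Lemma continuous_measurable_rVR d (f : 'rV[R]_d -> R) :
  continuous f -> measurable_fun setT (f : _ -> measurableTypeR R).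
Proof.
move=> cf; apply: (measurability _ (RGenOpens.measurableE R)).
move=> _ [_ [a [b ->] <-]]; rewrite setTI; apply: open_measurable_rV.
by move/continuousP : cf; apply; exact: interval_open.
Qed.

Lemma measurable_rV_boxes d : @measurable _ 'rV[R]_d =
  <<s [set box A | A in [set A : 'I_d -> set (measurableTypeR R) |
                          forall i, measurable (A i)]] >>.
Proof.
set G := (X in <<s X >>).
apply/seteqP; split => X; last first.
  move: X; apply: smallest_sub => //; first exact: sigma_algebra_measurable.
  by move=> _ [A mA <-]; exact: measurable_box.
move: X; apply: smallest_sub; first exact: smallest_sigma_algebra.
move=> U oU.
rewrite (open_bigcup_ball_rV oU) bigcup_mkcond.
apply: (@countable_bigcupT_measurable _ (g_sigma_algebraType G)).
  exact: countableP.
move=> -[q k]; case: ifPn => _; last exact: (@measurable0 _ (g_sigma_algebraType G)).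
apply: sub_sigma_algebra => /=.
exists (fun i => ball ((map_mx ratr q : 'rV[R]_d) 0 i : R) k.+1%:R^-1).
  by move=> i; exact: (open_measurable (ball_open _ _)).
apply/seteqP; split => [x cx|x [_ cx] i//]; split => [|i j].
  by rewrite invr_gt0.
by rewrite ord1; exact: cx.
Qed.

(** Boxes form a generating family stable under intersection, and the cubes with sides [I n] exhaust
    the space with finite volume, so two measures that agree on boxes coincide. Images of Lebesgue
    measure are identified this way. *)
Lemma volume_unique d (m : {measure set 'rV[R]_d -> \bar R}) :
  (forall A : 'I_d -> set (measurableTypeR R), (forall i, measurable (A i)) ->
    m (box A) = (\prod_(i < d) lebesgue_measure (A i))%E) ->
  forall X, measurable X -> volume X = m X.
Proof.
move=> mE X mX.
pose I (n : nat) : set (measurableTypeR R) := `]- n%:R, n%:R[%classic.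
have mI n : measurable (I n) by exact: measurable_itv.
apply: (measure_unique _ (fun n => box (fun=> I n)) (measurable_rV_boxes d)) => //.
- move=> _ _ [A mA <-] [B mB <-]; exists (fun i => A i `&` B i).
    by move=> i; exact: measurableI.
  apply/seteqP; split => [x AB|x [Ax Bx] i]; last by split; [exact: Ax|exact: Bx].
  by split => i; have [] := AB i.
- by move=> n; exists (fun=> I n).
- apply/seteqP; split => // x _.
  exists (Num.truncn (\sum_i `|x 0 i|)).+1 => // i.
  rewrite /I /= in_itv/= -ltr_norml.
  apply: le_lt_trans (truncnS_gt _).
  by rewrite (bigD1 i)//= lerDl sumr_ge0.
- move=> _ [A mA <-]; rewrite mE//; exact: volume_box.
- move=> n; rewrite -[X in (X < _)%E]/(volume (box (fun=> I n))) volume_box// -ge0_fin_numE;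
    last by apply: prode_ge0.
  apply: prode_fin_num => i _; rewrite /I lebesgue_measure_itv.
  by case: ifP.
Qed.

Lemma pushforward_measure d1 d2 (T1 : measurableType d1) (T2 : measurableType d2)
    (m : {measure set T1 -> \bar R}) (f : T1 -> T2) : measurable_fun setT f ->
  exists mu : {measure set T2 -> \bar R}, mu = pushforward m f :> (_ -> _).
Proof.
move=> mf.
by exists (measure_function_pushforward__canonical__measure_function_Measure m mf).
Qed.

(** The pushforward scaled by [|a|] gives each interval its length, which characterizes Lebesgue
    measure; the sign of [a] decides which end of the preimage interval is closed. *)
Lemma lebesgue_measure_affine (a b : R) (A : set (measurableTypeR R)) :
  a != 0 -> measurable A ->
  (lebesgue_measure ((fun x => a * x + b)%R @^-1` A) * `|a|%:E)%E = lebesgue_measure A.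
Proof.
move=> a0 mA.
have mf : measurable_fun setT (fun x : measurableTypeR R => a * x + b : measurableTypeR R).
  by apply: measurable_funD => //; exact: measurable_funM.
have [p pE] := pushforward_measure lebesgue_measure mf.
have a0' : 0 <= `|a| by [].
pose m := mscale (NngNum a0') p.
rewrite muleC; have -> : (`|a|%:E * lebesgue_measure ((fun x => a * x + b)%R @^-1` A))%E = m A.
  by rewrite /m /mscale /= pE.
apply/esym/lebesgue_measure_unique => // X [[c d] _ <-] /=.
rewrite /m /mscale /= pE /pushforward.
rewrite lebesgue_measure_itv/= lte_fin.
have [a_gt0|a_lt0|aE] := ltgtP 0 a; last by rewrite aE eqxx in a0.
- rewrite (_ : _ @^-1` _ = `](c - b) / a, (d - b) / a]%classic); last first.
    apply/seteqP; split => x /=; rewrite !in_itv/= ltr_pdivrMr// ler_pdivlMr//; lra.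
  rewrite lebesgue_measure_itv/= lte_fin ltr_pM2r ?invr_gt0// ltrD2r.
  case: ifP => _; last by rewrite mule0.
  by rewrite -!EFinB -EFinM ger0_norm ?ltW//; congr _%:E; field.
- rewrite (_ : _ @^-1` _ = `[(d - b) / a, (c - b) / a[%classic); last first.
    apply/seteqP; split => x /=; rewrite !in_itv/= ltr_ndivlMr// ler_ndivrMr//; lra.
  rewrite lebesgue_measure_itv/= lte_fin ltr_nM2r ?invr_lt0// ltrD2r.
  case: ifP => _; last by rewrite mule0.
  by rewrite -!EFinB -EFinM ltr0_norm//; congr _%:E; field.
Qed.
End volume_uniqueness.

Section volume_linear.
Context {R : realType}.

Lemma volumeS1 d (A : set 'rV[R]_d.+1) : measurable A ->
  volume A = (\int[lebesgue_measure]_x volume [set v | A (cons_rV (x, v))])%E.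
Proof.
move=> mA; rewrite /= /pushforward /product_measure1/=.
apply: eq_integral => x _; congr volume; apply/seteqP.
by split=> v /=; rewrite /xsection/= inE.
Qed.

Lemma measurable_preimage_cons_rV d (A : set 'rV[R]_d.+1) : measurable A ->
  measurable (@cons_rV R d @^-1` A).
Proof. by move=> mA; rewrite -[X in measurable X]setTI; exact: measurable_cons_rV. Qed.

(** Both iterated products agree on rectangles, hence everywhere. Here the first coordinate is
    integrated innermost, the order in which a shear along that coordinate is a mere translation of
    the line. *)
Lemma volumeS2 d (A : set 'rV[R]_d.+1) : measurable A ->
  volume A = (\int[volume]_v lebesgue_measure [set x | A (cons_rV (x, v))])%E.
Proof.
move=> mA; rewrite /= /pushforward.
have mE (B : set (measurableTypeR R)) (C : set 'rV[R]_d) : measurable B -> measurable C ->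
    (lebesgue_measure \x^ volume)%E (B `*` C) = (lebesgue_measure B * volume C)%E.
  by move=> mB mC; exact: product_measure2E.
have := product_measure_unique mE (measurable_preimage_cons_rV mA).
move=> h; transitivity ((lebesgue_measure \x^ volume)%E (@cons_rV R d @^-1` A)).
  exact: h.
rewrite /product_measure2/=; apply: eq_integral => x _; congr lebesgue_measure.
by apply/seteqP; split=> v /=; rewrite /ysection/= inE.
Qed.

Lemma measurable_volume_section d (A : set 'rV[R]_d.+1) : measurable A ->
  measurable_fun [set: measurableTypeR R] (fun x => volume [set v | A (cons_rV (x, v))]).
Proof.
move=> mA.
rewrite (_ : (fun x => _) = volume \o xsection (@cons_rV R d @^-1` A)).
  by apply: measurable_fun_xsection; exact: measurable_preimage_cons_rV.
apply/funext => x /=; congr volume.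
by apply/seteqP; split=> v /=; rewrite /xsection/= inE.
Qed.

Lemma measurable_lebesgue_section d (A : set 'rV[R]_d.+1) : measurable A ->
  measurable_fun [set: 'rV[R]_d] (fun v => lebesgue_measure [set x | A (cons_rV (x, v))]).
Proof.
move=> mA.
rewrite (_ : (fun x => _) = lebesgue_measure \o ysection (@cons_rV R d @^-1` A)).
  by apply: measurable_fun_ysection; exact: measurable_preimage_cons_rV.
apply/funext => x /=; congr lebesgue_measure.
by apply/seteqP; split=> v /=; rewrite /ysection/= inE.
Qed.

Lemma measurable_lebesgue_slice d (A : set 'rV[R]_d.+1) v : measurable A ->
  measurable [set x : measurableTypeR R | A (cons_rV (x, v))].
Proof.
move=> mA; have := measurable_ysection v (measurable_preimage_cons_rV mA).
by congr measurable; apply/seteqP; split=> x /=; rewrite /ysection/= inE.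
Qed.

Lemma measurable_volume_slice d (A : set 'rV[R]_d.+1) x : measurable A ->
  measurable [set v | A (cons_rV (x, v))].
Proof.
move=> mA; have := measurable_xsection x (measurable_preimage_cons_rV mA).
by congr measurable; apply/seteqP; split=> v /=; rewrite /xsection/= inE.
Qed.

Lemma continuous_rV (T : topologicalType) d (f : T -> 'rV[R]_d) :
  (forall i, continuous (fun x => f x 0 i)) -> continuous f.
Proof.
move=> cf x A [P nP PA].
have : \forall y \near x, forall j : 'I_d, P 0 j (f y 0 j).
  by apply: filter_forall => j; exact: cf (nP 0 j).
apply: filterS => y Py; apply: PA => i j; rewrite ord1; exact: Py.
Qed.

Lemma continuous_mulmxr d e (T : 'M[R]_(d, e)) : continuous (fun x : 'rV[R]_d => x *m T).
Proof.
apply: continuous_rV => i.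
rewrite (_ : (fun x => _) = (fun x : 'rV[R]_d => \sum_j x 0 j * T j i)).
  apply: continuous_big => [|j _ x]; first exact: add_continuous.
  by apply: continuousM; [exact: coord_continuous|exact: cst_continuous].
by apply/funext => x; rewrite mxE.
Qed.

Lemma measurable_preimage_mulmx d e (T : 'M[R]_(d, e)) A : measurable A ->
  measurable ((fun x : 'rV[R]_d => x *m T) @^-1` A).
Proof.
move=> mA; rewrite -[X in measurable X]setTI.
by apply: continuous_measurable_rV => //; exact: continuous_mulmxr.
Qed.

(** The change of variables formula, stated for preimages and with the determinant as a factor: no
    inverse of [T] and no division in the extended reals, and the property is stable under
    products. *)
Definition scales_volume d (T : 'M[R]_d) := forall A : set 'rV[R]_d, measurable A ->
  (volume ((fun x => x *m T) @^-1` A) * `|\det T|%:E)%E = volume A.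

Lemma scales_volumeM d (S T : 'M[R]_d) :
  scales_volume S -> scales_volume T -> scales_volume (S *m T).
Proof.
move=> hS hT A mA; rewrite det_mulmx normrM EFinM muleA.
rewrite -[in RHS]hT// -[in RHS]hS; last exact: measurable_preimage_mulmx.
by do 2 congr (_ * _)%E; congr volume; apply/seteqP; split => x /=; rewrite mulmxA.
Qed.

Lemma scales_volume_perm d (s : 'S_d) : scales_volume (perm_mx s).
Proof.
move=> A mA; rewrite det_perm normr_sign mule1.
have mf : measurable_fun setT (fun x : 'rV[R]_d => x *m perm_mx s).
  by apply: continuous_measurable_rV; exact: continuous_mulmxr.
have [m mE] := pushforward_measure volume mf.
rewrite -[LHS]/(pushforward volume (fun x => x *m perm_mx s) A) -mE.
apply/esym/volume_unique => // B mB; rewrite mE /pushforward.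
rewrite (_ : _ @^-1` _ = box (fun i => B (s i))).
  rewrite [RHS](reindex_inj (@perm_inj _ s)).
  by apply: (@volume_box R d (fun i => B (s i))).
apply/seteqP; split => x xB i.
  have := xB (s i); rewrite -[s in perm_mx s]invgK -col_permE mxE.
  by rewrite permK.
rewrite -[s in perm_mx s]invgK -col_permE mxE.
by have := xB (s^-1%g i); rewrite permKV.
Qed.

Lemma volume_translate d (b : 'rV[R]_d) (A : set 'rV[R]_d) : measurable A ->
  volume ((fun x => x + b) @^-1` A) = volume A.
Proof.
move=> mA.
have cf : continuous (fun x : 'rV[R]_d => x + b).
  by move=> x; apply: continuousD => //; exact: cst_continuous.
have mf := continuous_measurable_rV cf.
have [m mE] := pushforward_measure volume mf.
rewrite -[LHS]/(pushforward volume (fun x => x + b) A) -mE.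
apply/esym/volume_unique => // B mB; rewrite mE /pushforward.
have mB' i : measurable ((fun x : measurableTypeR R => 1 * x + b 0 i : measurableTypeR R) @^-1`
  B i).
  have mg : measurable_fun setT (fun x : measurableTypeR R => 1 * x + b 0 i : measurableTypeR
    R).
    by apply: measurable_funD => //; exact: measurable_funM.
  by rewrite -[X in measurable X]setTI; exact: mg.
rewrite (_ : _ @^-1` _ = box (fun i => (fun x : R => 1 * x + b 0 i) @^-1` B i)).
  apply: (etrans (volume_box mB')); apply: eq_bigr => i _.
  by rewrite -[RHS](@lebesgue_measure_affine R 1 (b 0 i)) ?oner_neq0// normr1 mule1.
by apply/seteqP; split => x xB i; have := xB i; rewrite /= !mxE mul1r.
Qed.

Lemma cons_rV_mulmx_lblock d (a : 'M[R]_1) (w : 'cV[R]_d) (T : 'M[R]_d) (x : R) v :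
  cons_rV (x, v) *m (block_mx a 0 w T : 'M[R]_d.+1) =
  cons_rV (a 0 0 * x + (v *m w) 0 0, v *m T).
Proof.
rewrite /cons_rV/= -[d.+1]/(1 + d)%N mul_row_block mulmx0 add0r; congr row_mx.
apply/matrixP => i j; rewrite !ord1 !mxE big_ord1 !mxE eqxx mulr1n mulrC.
by congr (_ + _).
Qed.

(** For fixed [v] the first coordinate undergoes the affine map [x |-> a x + v w], which contributes
    [|a|]; the remaining integral over [v] is transported by [T], which contributes [|det T|]. *)
Lemma scales_volume_lblock d (a : 'M[R]_1) (w : 'cV[R]_d) (T : 'M[R]_d) :
  a 0 0 != 0 -> scales_volume T ->
  scales_volume (block_mx a 0 w T : 'M[R]_d.+1).
Proof.
move=> a0 hT A mA.
rewrite -[d.+1]/(1 + d)%N det_lblock det_mx11 normrM EFinM muleA.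
rewrite volumeS2; last exact: measurable_preimage_mulmx.
set phi := fun v => lebesgue_measure [set x | A (cons_rV (x, v))].
have mphi : measurable_fun setT phi by exact: measurable_lebesgue_section.
rewrite -ge0_integralZr//; last first.
  by apply: measurable_lebesgue_section; exact: measurable_preimage_mulmx.
transitivity ((\int[volume]_v phi (v *m T)) * `|\det T|%:E)%E.
  congr (_ * _)%E; apply: eq_integral => v _; rewrite /phi.
  rewrite -(lebesgue_measure_affine ((v *m w) 0 0) a0 (measurable_lebesgue_slice (v *m T) mA)).
  congr (lebesgue_measure _ * _)%E; apply/seteqP; split => x/=.
    by rewrite cons_rV_mulmx_lblock.
  by rewrite cons_rV_mulmx_lblock.
have mf : measurable_fun setT (fun x : 'rV[R]_d => x *m T).
  by apply: continuous_measurable_rV; exact: continuous_mulmxr.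
rewrite -[(\int[volume]_v _)%E](@ge0_integral_pushforward _ _ _ _ R _ mf volume setT phi)//.
rewrite muleC.
have d0 : 0 <= `|\det T| by [].
rewrite -[`|\det T|%:E]/((NngNum d0)%:num%:E).
rewrite -ge0_integral_mscale//.
rewrite volumeS2//.
apply: eq_measure_integral => B mB _.
by rewrite /mscale/= -[RHS]hT// muleC.
Qed.

Lemma scales_volume_trig d (T : 'M[R]_d) : is_trig_mx T -> \det T != 0 ->
  scales_volume T.
Proof.
move: d T; apply: trigsqmx_ind => [_|n x w T _ IH].
  move=> A mA; rewrite det_mx00 normr1 mule1; congr volume.
  by apply/seteqP; split => v /=; rewrite mulmx0 (thinmx0 v).
rewrite det_lblock mulf_eq0 negb_or det_mx11 => /andP[x0 T0].
exact: scales_volume_lblock (IH T0).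
Qed.

(** Conjugation by the permutation that reverses the coordinates exchanges upper and lower
    triangular matrices. *)
Lemma scales_volume_trig_tr d (T : 'M[R]_d) : is_trig_mx T^T -> \det T != 0 ->
  scales_volume T.
Proof.
move=> /is_trig_mxP tT T0.
pose r : {perm 'I_d} := perm (@rev_ord_inj d).
have rK : (r * r = 1)%g by apply/permP => i; rewrite permM perm1 !permE rev_ordK.
have rV : (r^-1 = r)%g by rewrite -[LHS]mulg1 -rK mulKg.
have TE : T = perm_mx r *m (perm_mx r *m T *m perm_mx r) *m perm_mx r.
  by rewrite !mulmxA -perm_mxM rK perm_mx1 mul1mx -mulmxA -perm_mxM rK perm_mx1 mulmx1.
rewrite TE; apply: scales_volumeM; last exact: scales_volume_perm.
apply: scales_volumeM; first exact: scales_volume_perm.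
apply: scales_volume_trig.
  apply/is_trig_mxP => i j ij.
  rewrite -[X in _ *m perm_mx X]invgK -col_permE -row_permE !mxE rV !permE.
  have := tT (rev_ord j) (rev_ord i); rewrite mxE; apply.
  by rewrite /= ltn_sub2l ?ltnS// (leq_ltn_trans ij (ltn_ord j)).
by rewrite !det_mulmx !mulf_neq0// det_perm signr_eq0.
Qed.

(** By the LUP factorization an invertible matrix is a product of a permutation matrix and two
    triangular ones. Dimension 0 is separate because the factorization is stated in positive
    dimension. *)
Lemma scales_volume_unitmx d (T : 'M[R]_d) : T \in unitmx -> scales_volume T.
Proof.
case: d T => [|d] T; rewrite unitmxE unitfE => T0.
  apply: scales_volume_trig => //.
  by apply/is_trig_mxP => -[].
have [/is_perm_mxP[s sE] detL lowL upU PA] := And5 (cormen_lup_perm T) (cormen_lup_detL T)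
  (@cormen_lup_lower _ _ T) (@cormen_lup_upper _ _ T) (cormen_lup_correct T).
case: (cormen_lup T) sE detL lowL upU PA => [[P L] U]/= -> detL lowL upU PA.
have TE : T = perm_mx s^-1 *m L *m U.
  by rewrite -mulmxA -[L *m U]PA -mulmxE mulmxA -perm_mxM mulVg perm_mx1 mul1mx.
have U0 : \det U != 0.
  by apply: contraNneq T0 => U0; rewrite TE det_mulmx U0 mulr0.
rewrite TE; apply: scales_volumeM; first apply: scales_volumeM.
- exact: scales_volume_perm.
- apply: scales_volume_trig; last by rewrite detL oner_neq0.
  apply/is_trig_mxP => i j ij.
  by rewrite lowL ?(ltnW ij)// -val_eqE ltn_eqF.
- apply: scales_volume_trig_tr => //.
  by apply/is_trig_mxP => i j ij; rewrite mxE upU.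
Qed.

End volume_linear.

(** * The inequalities of Prékopa-Leindler and Brunn-Minkowski *)

Section brunn_minkowski_line.
Context {R : realType}.
Local Notation mu := (@lebesgue_measure R).

(** With [a] the maximum of [A] and [b] the minimum of [B], the sets [(1 - l) A + l b] and
    [(1 - l) a + l B] both lie in [C], on either side of [p], and can meet only at [p]. Removing
    this null point makes their measures add up. They are written as the preimages by [fA] and
    [fB]. *)
Lemma brunn_minkowski_compact (l : R) (A B C : set (measurableTypeR R)) :
  0 < l -> l < 1 -> compact (A : set R) -> A !=set0 -> compact (B : set R) -> B !=set0 ->
  measurable C ->
  (forall x y, A x -> B y -> C ((1 - l) * x + l * y)) ->
  ((1 - l)%:E * mu A + l%:E * mu B <= mu C)%E.
Proof.
move=> l0 l1 cA A0 cB B0 mC ABC.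
have l10 : 0 < 1 - l by lra.
have mA : measurable A by exact: compact_measurable.
have mB : measurable B by exact: compact_measurable.
have [a aA aM] : exists2 a, A a & forall t, A t -> t <= a.
  have [|a aA aM] := @compact_EVT_max _ R id A A0 cA.
    by apply: continuous_subspaceT => x; exact: cvg_id.
  by exists a => [|t tA]; [rewrite inE in aA|apply: aM; rewrite inE].
have [b bB bm] : exists2 b, B b & forall t, B t -> b <= t.
  have [|b bB bm] := @compact_EVT_min _ R id B B0 cB.
    by apply: continuous_subspaceT => x; exact: cvg_id.
  by exists b => [|t tB]; [rewrite inE in bB|apply: bm; rewrite inE].
set p := (1 - l) * a + l * b.
pose fA x := (1 - l)^-1 * x + - ((1 - l)^-1 * (l * b)).
pose fB x := l^-1 * x + - (l^-1 * ((1 - l) * a)).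
have mpre (u v : R) (D : set (measurableTypeR R)) : measurable D ->
    measurable ((fun x : measurableTypeR R => u * x + v : measurableTypeR R) @^-1` D).
  move=> mD; rewrite -[X in measurable X]setTI.
  have mg : measurable_fun setT (fun x : measurableTypeR R => u * x + v : measurableTypeR R).
    by apply: measurable_funD => //; exact: measurable_funM.
  exact: mg.
have <- : mu (fA @^-1` A) = ((1 - l)%:E * mu A)%E.
  rewrite -(@lebesgue_measure_affine R (1 - l)^-1 (- ((1 - l)^-1 * (l * b))) A)//.
    by rewrite muleCA -EFinM gtr0_norm ?invr_gt0// mulfV ?gt_eqF// mule1.
  by rewrite invr_eq0 gt_eqF.
have <- : mu (fB @^-1` B) = (l%:E * mu B)%E.
  rewrite -(@lebesgue_measure_affine R l^-1 (- (l^-1 * ((1 - l) * a))) B)//.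
    by rewrite muleCA -EFinM gtr0_norm ?invr_gt0// mulfV ?gt_eqF// mule1.
  by rewrite invr_eq0 gt_eqF.
have mfA : measurable (fA @^-1` A) by exact: mpre.
have mfB : measurable (fB @^-1` B) by exact: mpre.
have mp : measurable [set p : measurableTypeR R] by exact: measurable_set1.
have -> : mu (fB @^-1` B) = mu (fB @^-1` B `\` [set p]).
  rewrite (measureDI mu mfB mp).
  rewrite [X in (_ + X)%E](_ : _ = 0%E) ?adde0//; apply/eqP.
  rewrite eq_le measure_ge0 andbT -(lebesgue_measure_set1 p).
  by apply: le_measure; rewrite ?inE//; exact: measurableI.
rewrite -measureU//; last 2 first.
- exact: measurableD.
- rewrite -subset0 => x /= [] fAx [] fBx; apply.
  have hA : (1 - l) * fA x + l * b = x by rewrite /fA; field; rewrite gt_eqF.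
  have hB : (1 - l) * a + l * fB x = x by rewrite /fB; field; rewrite gt_eqF.
  apply/eqP; rewrite eq_le; apply/andP; split.
    by rewrite -hA lerD2r ler_pM2l// aM.
  by rewrite -hB lerD2l ler_pM2l// bm.
apply: le_measure; rewrite ?inE//.
  by apply: measurableU => //; exact: measurableD.
move=> x [fAx|[fBx _]].
  rewrite (_ : x = (1 - l) * fA x + l * b); first exact: ABC.
  by rewrite /fA; field; rewrite gt_eqF.
rewrite (_ : x = (1 - l) * a + l * fB x); first exact: ABC.
by rewrite /fB; field; rewrite gt_eqF.
Qed.

(** Inner regularity reduces to compact subsets, first of [B] and then of [A]. Since these may be
    empty, the points [a] and [b] are added to them before the compact case is applied. *)
Lemma brunn_minkowski_line (l : R) (A B C : set (measurableTypeR R)) :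
  0 < l -> l < 1 -> measurable A -> A !=set0 -> measurable B -> B !=set0 ->
  measurable C ->
  (forall x y, A x -> B y -> C ((1 - l) * x + l * y)) ->
  ((1 - l)%:E * mu A + l%:E * mu B <= mu C)%E.
Proof.
move=> l0 l1 mA [a Aa] mB [b Bb] mC ABC.
have l10 : 0 < 1 - l by lra.
have key (K L : set (measurableTypeR R)) : compact (K : set R) -> K `<=` A -> compact (L : set
  R) ->
    L `<=` B -> ((1 - l)%:E * mu K + l%:E * mu L <= mu C)%E.
  move=> cK KA cL LB.
  have cKa : compact ((K `|` [set a]) : set R) by apply: compactU => //; exact: compact_set1.
  have cLb : compact ((L `|` [set b]) : set R) by apply: compactU => //; exact: compact_set1.
  apply: (@le_trans _ _ ((1 - l)%:E * mu (K `|` [set a]) + l%:E * mu (L `|` [set b]))%E).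
    have leU (D : set (measurableTypeR R)) x : compact (D : set R) ->
        compact ((D `|` [set x]) : set R) -> (mu D <= mu (D `|` [set x]))%E.
      by move=> cD cDx; apply: le_measure; rewrite ?inE; [exact: compact_measurable..|exact:
        subsetUl].
    by apply: leeD; apply: lee_wpmul2l; [rewrite lee_fin ltW|exact: leU|rewrite lee_fin
      ltW|exact: leU].
  apply: brunn_minkowski_compact => //.
  - by exists a; right.
  - by exists b; right.
  - by move=> x y [/KA Ax|->] [/LB By|->]; exact: ABC.
have [->|Coo] := eqVneq (mu C) +oo%E; first by rewrite leey.
have keyB (K : set (measurableTypeR R)) : compact (K : set R) -> K `<=` A ->
    ((1 - l)%:E * mu K + l%:E * mu B <= mu C)%E.
  move=> cK KA.
  have Kfin : ((1 - l)%:E * mu K)%E \is a fin_num.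
    by rewrite fin_numM// ge0_fin_numE//; exact: compact_finite_measure.
  rewrite addeC -leeBrDr// -lee_pdivlMl// (lebesgue_regularity_inner_sup mB).
  apply: ge_ereal_sup => _ [L [cL LB] <-].
  by rewrite lee_pdivlMl// leeBrDr// addeC; exact: key.
(* Moving this term across the inequality requires it to be finite; the case of the empty [K] bounds
   it by [mu C]. *)
have Bfin : (l%:E * mu B)%E \is a fin_num.
  rewrite ge0_fin_numE; last by rewrite mule_ge0// lee_fin ltW.
  apply: (@le_lt_trans _ _ (mu C)); last by rewrite ltey.
  have := keyB set0 compact0 (@sub0set _ _).
  by rewrite measure0 mule0 add0e.
rewrite -leeBrDr// -lee_pdivlMl// (lebesgue_regularity_inner_sup mA).
apply: ge_ereal_sup => _ [K [cK KA] <-].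
by rewrite lee_pdivlMl// leeBrDr//; exact: keyB.
Qed.

Lemma measurable_subgraph (f : measurableTypeR R -> R) : measurable_fun setT f ->
  measurable [set p : measurableTypeR R * measurableTypeR R | p.2 < f p.1].
Proof.
move=> mf.
have mfst : measurable_fun setT (fun p : measurableTypeR R * measurableTypeR R => f p.1).
  exact: measurableT_comp.
have := measurable_fun_ltr (D := setT) (f := fun p : measurableTypeR R * measurableTypeR R =>
  p.2 : R) (g := fun p => f p.1) measurable_snd mfst.
by move=> /(_ measurableT [set true] I); congr measurable; apply/seteqP; split => x [].
Qed.

Lemma measurable_fun_superlevel (f : measurableTypeR R -> R) : measurable_fun setT f ->
  measurable_fun [set: measurableTypeR R] (fun t => mu [set x | t < f x]).
Proof.
move=> mf; have := measurable_fun_ysection mu (measurable_subgraph mf).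
by congr measurable_fun; apply/funext => t /=; congr mu; apply/seteqP; split => x;
  rewrite /ysection/= inE.
Qed.

(** Tonelli for the region [0 <= t < 1], [t < f x], whose slice at [x] is an interval of length
    [min (f x) 1]. Levels stop at 1 because below that level the superlevel sets of functions of
    supremum 1 are nonempty. *)
Lemma layer_cake (f : measurableTypeR R -> R) : measurable_fun setT f -> (forall x, 0 <= f x) ->
  (\int[mu]_x (Num.min (f x) 1)%:E = \int[mu]_(t in `[0%R, 1%R[) mu [set x | (t < f x)%R])%E.
Proof.
move=> mf f0.
pose E := [set p : measurableTypeR R * measurableTypeR R | [/\ 0 <= p.2, p.2 < 1 & p.2 < f
  p.1]].
have mE : measurable E.
  rewrite (_ : E = [set: _] `*` `[0%R, 1%R[ `&` [set p | p.2 < f p.1]).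
    apply: measurableI.
      by apply: measurableX => //; exact: measurable_itv.
    exact: measurable_subgraph.
  apply/seteqP; split => [p [p0 p1 pf]|p [[_ /=]]].
    by split => //; split => //=; rewrite in_itv/= p0.
  by rewrite in_itv/= => /andP[].
have := product_measure_unique (m1 := mu) (m2 := mu) (m' := (mu \x^ mu)%E).
move=> /(_ _ E mE) h.
have {h} : (mu \x mu)%E E = (mu \x^ mu)%E E.
  by apply: h => A B mA mB; exact: product_measure2E.
rewrite [X in X = _ -> _]/product_measure1 [X in _ = X -> _]/product_measure2 /=.
move=> h; transitivity (\int[mu]_x (mu \o xsection E) x)%E.
  apply: eq_integral => x _ /=.
  rewrite (_ : xsection E x = `[0, Num.min (f x) 1[%classic).
    rewrite lebesgue_measure_itv/= lte_fin; case: ifPn.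
      by rewrite oppr0 adde0.
    rewrite -leNgt => h1; congr _%:E; apply/eqP; rewrite eq_le h1/=.
    by rewrite le_min f0/=.
  apply/seteqP; split => t /=; rewrite /xsection/= in_itv/= lt_min inE/E/=.
    by case=> -> -> ->.
  by case/and3P.
rewrite [LHS]h [RHS]integral_mkcond; apply: eq_integral => t _ /=.
rewrite patchE; case: ifPn.
  rewrite inE /= in_itv/= => /andP[t0 t1]; congr mu; apply/seteqP.
  split => x /=; rewrite /ysection/= inE /E/=; first by case.
  by rewrite t0 t1.
move=> tN; rewrite (_ : ysection E t = set0) ?measure0//.
rewrite -subset0 => x; rewrite /ysection/= inE /E/= => -[t0 t1 _].
by move/negP: tN; apply; rewrite inE/= in_itv/= t0.
Qed.
End brunn_minkowski_line.

Section prekopa_leindler.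
Context {R : realType}.
Local Notation mu := (@lebesgue_measure R).

Lemma measurable_superlevel (f : measurableTypeR R -> R) (t : R) : measurable_fun setT f ->
  measurable [set x | t < f x].
Proof.
move=> mf; have := emeasurable_fun_o_infty measurableT (f := EFin \o f) _ t%:E.
rewrite setTI (_ : [set x | (t%:E < (EFin \o f) x)%E] = [set x | t < f x]); last first.
  by apply/seteqP; split => x /=; rewrite lte_fin.
by apply; exact/measurable_EFinP.
Qed.

Lemma weighted_AMGM (l a b : R) : 0 < l -> l < 1 -> 0 <= a -> 0 <= b ->
  a `^ (1 - l) * b `^ l <= (1 - l) * a + l * b.
Proof.
move=> l0 l1 a0 b0; have l10 : 0 < 1 - l by lra.
have := @conjugate_powR R (a `^ (1 - l)) (b `^ l) (1 - l)^-1 l^-1.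
rewrite !powR_ge0 !invr_gt0 !invrK subrK -!powRrM !mulfV ?gt_eqF// !powRr1//.
by move=> /(_ isT isT l10 l0 erefl); rewrite [a * _]mulrC [b * _]mulrC.
Qed.

(** For [0 <= t < 1] the sets [{f > t}] and [{g > t}] are nonempty and combine into [{h > t}], so
    Brunn-Minkowski on the line applies level by level and is integrated in [t]. Having supremum 1
    on both sides is what yields the arithmetic mean here. *)
Lemma prekopa_leindler_normalized (l : R) (f g h : measurableTypeR R -> R) :
  0 < l -> l < 1 ->
  measurable_fun setT f -> measurable_fun setT g -> measurable_fun setT h ->
  (forall x, 0 <= f x <= 1) -> (forall x, 0 <= g x <= 1) -> (forall x, 0 <= h x) ->
  (forall t, t < 1 -> exists x, t < f x) -> (forall t, t < 1 -> exists x, t < g x) ->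
  (forall x y, f x `^ (1 - l) * g y `^ l <= h ((1 - l) * x + l * y)) ->
  ((1 - l)%:E * (\int[mu]_x (f x)%:E) + l%:E * (\int[mu]_x (g x)%:E) <= \int[mu]_x (h x)%:E)%E.
Proof.
move=> l0 l1 mf mg mh f01 g01 h0 fs gs fgh.
have l10 : 0 < 1 - l by lra.
have f0 x : 0 <= f x by case/andP: (f01 x).
have g0 x : 0 <= g x by case/andP: (g01 x).
have fE : (\int[mu]_x (f x)%:E = \int[mu]_(t in `[0%R, 1%R[) mu [set x | (t < f x)%R])%E.
  rewrite -layer_cake//; apply: eq_integral => x _.
  by rewrite min_l//; case/andP: (f01 x).
have gE : (\int[mu]_x (g x)%:E = \int[mu]_(t in `[0%R, 1%R[) mu [set x | (t < g x)%R])%E.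
  rewrite -layer_cake//; apply: eq_integral => x _.
  by rewrite min_l//; case/andP: (g01 x).
have hE : (\int[mu]_(t in `[0%R, 1%R[) mu [set x | (t < h x)%R] <= \int[mu]_x (h x)%:E)%E.
  rewrite -layer_cake//; apply: ge0_le_integral => //.
  - by move=> x _; rewrite lee_fin le_min h0/=.
  - by apply/measurable_EFinP; apply: measurable_minr.
  - by apply/measurable_EFinP.
  - by move=> x _; rewrite lee_fin ge_min lexx.
have mlev (k : measurableTypeR R -> R) : measurable_fun setT k ->
    measurable_fun (`[0%R, 1%R[%classic : set (measurableTypeR R)) (fun t => mu [set x | t < k
      x]).
  move=> mk; apply: (@measurable_funS _ _ _ _ setT) => //.
  exact: measurable_fun_superlevel.
apply: le_trans hE; rewrite fE gE.
have sE (c : R) (k : measurableTypeR R -> R) : 0 <= c -> measurable_fun setT k ->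
    (c%:E * \int[mu]_(t in `[0%R, 1%R[) mu [set x | (t < k x)%R] =
     \int[mu]_(t in `[0%R, 1%R[) (c%:E * mu [set x | (t < k x)%R]))%E.
  by move=> c0 mk; rewrite ge0_integralZl//; exact: mlev.
rewrite (sE _ _ (ltW l10) mf) (sE _ _ (ltW l0) mg) -ge0_integralD//; first last.
- by apply: measurable_funeM; exact: mlev.
- by move=> t _; rewrite mule_ge0// lee_fin ltW.
- by apply: measurable_funeM; exact: mlev.
- by move=> t _; rewrite mule_ge0// lee_fin ltW.
apply: ge0_le_integral => //.
- by move=> t _; rewrite adde_ge0// mule_ge0// lee_fin ltW.
- by apply: emeasurable_funD; apply: measurable_funeM; exact: mlev.
- exact: mlev.
move=> t; rewrite /= in_itv/= => /andP[t0 t1].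
apply: brunn_minkowski_line => //.
- exact: measurable_superlevel.
- exact: fs.
- exact: measurable_superlevel.
- exact: gs.
- exact: measurable_superlevel.
move=> x y /= tx ty; apply: lt_le_trans (fgh x y).
have -> : t = t `^ (1 - l) * t `^ l.
  have [->|tn0] := eqVneq t 0; first by rewrite powR0 ?mul0r// gt_eqF.
  by rewrite -powRD ?tn0 ?implybT// subrK powRr1.
apply: ltr_pM; rewrite ?powR_ge0//; apply: gt0_ltr_powR => //; rewrite nnegrE//;
  exact/ltW/(le_lt_trans t0).
Qed.
(** Divide [f] and [g] by their suprema [F] and [G], and [h] by [H], the matching geometric mean;
    the arithmetic mean obtained for the normalized functions dominates the geometric one. If [a] or
    [b] is 0, so is the left-hand side. *)
Lemma prekopa_leindler (l a b M : R) (f g h : measurableTypeR R -> R) :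
  0 < l -> l < 1 ->
  measurable_fun setT f -> measurable_fun setT g -> measurable_fun setT h ->
  (forall x, 0 <= f x <= M) -> (forall x, 0 <= g x <= M) -> (forall x, 0 <= h x) ->
  (forall x y, f x `^ (1 - l) * g y `^ l <= h ((1 - l) * x + l * y)) ->
  (\int[mu]_x (f x)%:E = a%:E)%E -> (\int[mu]_x (g x)%:E = b%:E)%E ->
  ((a `^ (1 - l) * b `^ l)%:E <= \int[mu]_x (h x)%:E)%E.
Proof.
move=> l0 l1 mf mg mh fM gM h0 fgh fa gb.
have l10 : 0 < 1 - l by lra.
have a0 : 0 <= a by rewrite -lee_fin -fa integral_ge0// => x _; rewrite lee_fin; case/andP: (fM
  x).
have b0 : 0 <= b by rewrite -lee_fin -gb integral_ge0// => x _; rewrite lee_fin; case/andP: (gM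
  x).
have ih0 : (0 <= \int[mu]_x (h x)%:E)%E by apply: integral_ge0 => x _; rewrite lee_fin.
have [a_eq0|a_neq0] := eqVneq a 0; first by rewrite a_eq0 powR0 ?mul0r// gt_eqF.
have [b_eq0|b_neq0] := eqVneq b 0; first by rewrite b_eq0 powR0 ?mulr0// gt_eqF.
have normalize (k : measurableTypeR R -> R) (c : R) : measurable_fun setT k ->
    (forall x, 0 <= k x <= M) -> (\int[mu]_x (k x)%:E = c%:E)%E -> c != 0 ->
    exists2 S : R, 0 < S & (forall x, 0 <= S^-1 * k x <= 1) /\
      (forall t, t < 1 -> exists x, t < S^-1 * k x) /\
      (\int[mu]_x (S^-1 * k x)%:E = (S^-1 * c)%:E)%E.
  move=> mk kM kc c0; pose S := sup (range k).
  have hs : has_sup (range k).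
    by split; [exists (k 0), 0|exists M => _ [x _ <-]; case/andP: (kM x)].
  have kS x : k x <= S by apply: ub_le_sup; [case: hs|exists x].
  have S0 : 0 < S.
    rewrite lt_neqAle (le_trans _ (kS 0)) ?andbT; last by case/andP: (kM 0).
    apply: contra_neq c0 => S0.
    suff : (c%:E = 0)%E by case.
    rewrite -kc integral0_eq// => x _; congr _%:E; apply/eqP.
    by rewrite eq_le {1}S0 kS/=; case/andP: (kM x).
  exists S => //; split=> [x|]; last split.
  - case/andP: (kM x) => k0 _.
    by rewrite mulr_ge0 ?invr_ge0 ?(ltW S0)//= mulrC ler_pdivrMr// mul1r kS.
  - move=> t t1; have [|_ [x _ <-] tx] := @sup_gt _ (range k) (t * S) hs.1.
      by rewrite gtr_pMl.
    by exists x; rewrite mulrC ltr_pdivlMr.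
  - under eq_integral do rewrite EFinM.
    rewrite ge0_integralZl_EFin ?kc ?EFinM// ?invr_ge0 ?(ltW S0)//.
    + by move=> x _; rewrite lee_fin; case/andP: (kM x).
    + exact/measurable_EFinP.
have [F F0 [f01 [fs fi]]] := normalize f a mf fM fa a_neq0.
have [G G0 [g01 [gs gi]]] := normalize g b mg gM gb b_neq0.
pose H := F `^ (1 - l) * G `^ l.
have H0 : 0 < H by rewrite mulr_gt0// powR_gt0.
have f0 x : 0 <= f x by case/andP: (fM x).
have g0 x : 0 <= g x by case/andP: (gM x).
have : ((1 - l)%:E * (\int[mu]_x (F^-1 * f x)%:E) + l%:E * (\int[mu]_x (G^-1 * g x)%:E)
    <= \int[mu]_x (H^-1 * h x)%:E)%E.
  apply: prekopa_leindler_normalized => //.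
  - exact: measurable_funM.
  - exact: measurable_funM.
  - exact: measurable_funM.
  - by move=> x; rewrite mulr_ge0// invr_ge0 ltW.
  - move=> x y; rewrite !powRM ?invr_ge0 ?(ltW F0) ?(ltW G0)//.
    rewrite mulrACA -!powR_inv1 ?(ltW F0) ?(ltW G0) ?(ltW H0)//.
    rewrite -!powRrM ![(-1) * _]mulrC !powRrM -powRM ?powR_ge0// -/H.
    by rewrite ler_wpM2l// powR_ge0.
have -> : (\int[mu]_x (H^-1 * h x)%:E = H^-1%:E * \int[mu]_x (h x)%:E)%E.
  under eq_integral do rewrite EFinM.
  rewrite ge0_integralZl_EFin// ?invr_ge0 ?(ltW H0)//.
  - by move=> x _; rewrite lee_fin.
  - exact/measurable_EFinP.
rewrite fi gi -!EFinM -EFinD lee_pdivlMl//; apply: le_trans.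
rewrite -EFinM lee_fin.
have aE : a = F * (F^-1 * a) by rewrite mulrA mulfV ?mul1r// gt_eqF.
have bE : b = G * (G^-1 * b) by rewrite mulrA mulfV ?mul1r// gt_eqF.
have aF0 : 0 <= F^-1 * a by rewrite mulr_ge0// invr_ge0 ltW.
have bG0 : 0 <= G^-1 * b by rewrite mulr_ge0// invr_ge0 ltW.
rewrite {1}aE {1}bE (powRM _ (ltW F0) aF0) (powRM _ (ltW G0) bG0) mulrACA -/H ler_pM2l//.
exact: weighted_AMGM.
Qed.

Definition cube d (M : R) : set 'rV[R]_d := box (fun=> `[- M, M]%classic).

Lemma measurable_cube d (M : R) : measurable (@cube d M).
Proof. by apply: (@measurable_box R d (fun=> `[- M, M]%classic)) => i; exact: measurable_itv.
  Qed.

Lemma volume_cube_fin d (M : R) : volume (@cube d M) \is a fin_num.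
Proof.
rewrite (@volume_box R d (fun=> `[- M, M]%classic)); last by move=> i; exact: measurable_itv.
by apply: prode_fin_num => i _; rewrite lebesgue_measure_itv; case: ifP.
Qed.

Lemma volume_sub_cube_fin d (M : R) (A : set 'rV[R]_d) : measurable A -> A `<=` @cube d M ->
  volume A \is a fin_num.
Proof.
move=> mA AM; rewrite ge0_fin_numE//.
apply: (@le_lt_trans _ _ (volume (@cube d M))).
  by apply: le_measure; rewrite ?inE//; exact: measurable_cube.
by rewrite -ge0_fin_numE//; exact: volume_cube_fin.
Qed.

Lemma cube_slice d (M : R) (A : set 'rV[R]_d.+1) x : A `<=` @cube d.+1 M ->
  [set v | A (cons_rV (x, v))] `<=` @cube d M.
Proof. by move=> AM v /AM Av i; have := Av (lift ord0 i); rewrite cons_rVS. Qed.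

Lemma cons_rV_comb d (a b x y : R) (v w : 'rV[R]_d) :
  a *: cons_rV (x, v) + b *: cons_rV (y, w) = cons_rV (a * x + b * y, a *: v + b *: w).
Proof.
by rewrite /cons_rV/= -[d.+1]/(1 + d)%N !scale_row_mx add_row_mx !scale_scalar_mx -raddfD.
Qed.

(** By induction on the dimension, slices along the first coordinate satisfy the same inequality,
    which is exactly the hypothesis of Prékopa-Leindler for the slice volumes. The common cube makes
    these volumes finite and uniformly bounded. *)
Lemma brunn_minkowski d (l M : R) (A B C : set 'rV[R]_d) : 0 < l -> l < 1 ->
  measurable A -> measurable B -> measurable C ->
  A `<=` @cube d M -> B `<=` @cube d M -> C `<=` @cube d M ->
  (forall x y, A x -> B y -> C ((1 - l) *: x + l *: y)) ->
  fine (volume A) `^ (1 - l) * fine (volume B) `^ l <= fine (volume C).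
Proof.
move=> l0 l1; have l10 : 0 < 1 - l by lra.
elim: d A B C => [|d IH] A B C mA mB mC AM BM CM ABC.
  have dE (D : set 'rV[R]_0) : volume D = (0 \in D)%:R%:E by rewrite /= /dirac indicE.
  rewrite !dE /=.
  have [A0|A0] := boolP (0 \in A); last by rewrite powR0 ?mul0r// gt_eqF.
  have [B0|B0] := boolP (0 \in B); last by rewrite powR0 ?mulr0// gt_eqF.
  rewrite mem_set; first by rewrite !powR1 mulr1.
  have := ABC _ _ (set_mem A0) (set_mem B0).
  by rewrite !scaler0 addr0.
have fin (D : set 'rV[R]_d.+1) x : measurable D -> D `<=` @cube _ M ->
    volume [set v | D (cons_rV (x, v))] \is a fin_num.
  move=> mD DM; apply: (@volume_sub_cube_fin _ M); last exact: cube_slice.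
  exact: measurable_volume_slice.
have bnd (D : set 'rV[R]_d.+1) x : measurable D -> D `<=` @cube _ M ->
    0 <= fine (volume [set v | D (cons_rV (x, v))]) <= fine (volume (@cube d M)).
  move=> mD DM; rewrite fine_ge0//= fine_le ?fin ?volume_cube_fin//.
  apply: le_measure; rewrite ?inE; [exact: measurable_volume_slice|exact: measurable_cube|].
  exact: cube_slice.
have volE (D : set 'rV[R]_d.+1) : measurable D -> D `<=` @cube _ M ->
    (\int[mu]_x (fine (volume [set v | D (cons_rV (x, v))]))%:E = (fine (volume D))%:E)%E.
  move=> mD DM; rewrite fineK; last exact: volume_sub_cube_fin DM.
  by rewrite volumeS1//; apply: eq_integral => x _; rewrite fineK// fin.
rewrite -lee_fin -(volE C)//.
apply: (@prekopa_leindler l _ _ (fine (volume (@cube d M)))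
  (fun x => fine (volume [set v | A (cons_rV (x, v))]))
  (fun x => fine (volume [set v | B (cons_rV (x, v))]))) => //.
- by apply: measurableT_comp => //; exact: measurable_volume_section.
- by apply: measurableT_comp => //; exact: measurable_volume_section.
- by apply: measurableT_comp => //; exact: measurable_volume_section.
- by move=> x; exact: bnd.
- by move=> x; exact: bnd.
- by move=> x; exact: fine_ge0.
- move=> x y; apply: IH; try exact: measurable_volume_slice; try exact: cube_slice.
  by move=> v w Av Bw; rewrite /= -cons_rV_comb; exact: ABC.
- exact: volE.
- exact: volE.
Qed.

End prekopa_leindler.

(** * Log-concave densities on the line *)

(** Log-concavity is multiplicative, with exponents strictly between 0 and 1, so that it makes sense
    where [f] vanishes. Boundedness and compact support are those of the marginals of a convex body
    and make every moment finite. *)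
Record log_concave_density (R : realType) (M : R) (f : measurableTypeR R -> R) : Prop := {
  lcd_measurable : measurable_fun setT f ;
  lcd_bounded : exists B, forall x, 0 <= f x <= B ;
  lcd_support : forall x, M <= `|x| -> f x = 0 ;
  lcd_concave : forall l x y, 0 < l -> l < 1 ->
    f x `^ (1 - l) * f y `^ l <= f ((1 - l) * x + l * y) ;
  lcd_mass : (\int[lebesgue_measure]_x (f x)%:E = 1)%E }.

Section ge0_integral_real.
Context d (T : measurableType d) (R : realType) (m : {measure set T -> \bar R}).

Lemma ge0_integralZ_real (f : T -> R) a : measurable_fun setT f -> (forall x, 0 <= f x) -> 0 <=
  a ->
  (\int[m]_x (a * f x)%:E = a%:E * \int[m]_x (f x)%:E)%E.
Proof.
move=> mf f0 a0; under eq_integral do rewrite EFinM.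
by rewrite ge0_integralZl_EFin//; [move=> x _; rewrite lee_fin|exact/measurable_EFinP].
Qed.

Lemma ge0_integralD_real (f g : T -> R) : measurable_fun setT f -> (forall x, 0 <= f x) ->
  measurable_fun setT g -> (forall x, 0 <= g x) ->
  (\int[m]_x (f x + g x)%:E = \int[m]_x (f x)%:E + \int[m]_x (g x)%:E)%E.
Proof.
move=> mf f0 mg g0; under eq_integral do rewrite EFinD.
by rewrite ge0_integralD//; [move=> x _; rewrite lee_fin|exact/measurable_EFinP|
  move=> x _; rewrite lee_fin|exact/measurable_EFinP].
Qed.

Lemma ge0_le_integral_real (f g : T -> R) : measurable_fun setT f -> measurable_fun setT g ->
  (forall x, 0 <= f x) -> (forall x, f x <= g x) ->
  (\int[m]_x (f x)%:E <= \int[m]_x (g x)%:E)%E.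
Proof.
move=> mf mg f0 fg; apply: ge0_le_integral => //.
- by move=> x _; rewrite lee_fin.
- exact/measurable_EFinP.
- exact/measurable_EFinP.
- by move=> x _; rewrite lee_fin.
Qed.

End ge0_integral_real.

Section log_concave.
Context {R : realType}.
Local Notation mu := (@lebesgue_measure R).

Lemma ge0_integral_shift (s : R) (g : measurableTypeR R -> R) : measurable_fun setT g ->
  (forall x, 0 <= g x) -> (\int[mu]_x (g (x + s))%:E = \int[mu]_x (g x)%:E)%E.
Proof.
move=> mg g0.
have ms : measurable_fun setT (fun x : measurableTypeR R => x + s : measurableTypeR R).
  exact: measurable_funD.
rewrite -[LHS](@ge0_integral_pushforward _ _ _ _ R _ ms mu setT (fun x => (g x)%:E))//.
- apply: eq_measure_integral => A mA _.
  have := @lebesgue_measure_affine R 1 s A (oner_neq0 _) mA.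
  rewrite normr1 mule1 => h; apply: etrans _ h; rewrite /= /pushforward.
  by congr (lebesgue_measure _); apply/seteqP; split => x /=; rewrite mul1r.
- exact/measurable_EFinP.
- by move=> x _; rewrite lee_fin.
Qed.

Variables (M : R) (f : measurableTypeR R -> R).
Hypothesis lf : log_concave_density M f.

Let mf := lcd_measurable lf.
Let f0 x : 0 <= f x. Proof. by have [B fB] := lcd_bounded lf; case/andP: (fB x). Qed.

(** The points [x + h] and [y] are the combinations of [x] and [y + h] with exchanged weights [l]
    and [1 - l]; the product of the two log-concavity inequalities is the claim. It transports a
    decay ratio found at one point to every point farther out. *)
Lemma lcd_swap x y h : x <= y -> 0 <= h -> f x * f (y + h) <= f (x + h) * f y.
Proof.
move=> xy h0.
have [->|h_neq0] := eqVneq h 0; first by rewrite !addr0.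
have [<-|x_neqy] := eqVneq x y; first by rewrite mulrC.
have hp : 0 < h by rewrite lt_neqAle eq_sym h_neq0.
have xyp : x < y by rewrite lt_neqAle x_neqy.
pose l := h / (y + h - x).
have d0 : 0 < y + h - x by lra.
have l0 : 0 < l by rewrite divr_gt0.
have l1 : l < 1 by rewrite ltr_pdivrMr//; lra.
have l10 : 0 < 1 - l by lra.
have h1 := lcd_concave lf x (y + h) l0 l1.
have e1 : (1 - l) * x + l * (y + h) = x + h by rewrite /l; field; rewrite gt_eqF.
have l11 : 1 - l < 1 by lra.
have h2 := lcd_concave lf x (y + h) l10 l11.
have e2 : (1 - (1 - l)) * x + (1 - l) * (y + h) = y by rewrite /l; field; rewrite gt_eqF.
have e3 : 1 - (1 - l) = l by ring.
rewrite e1 in h1; rewrite e2 e3 in h2.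
have pE u : f u = f u `^ (1 - l) * f u `^ l.
  have [->|fn0] := eqVneq (f u) 0; first by rewrite powR0 ?mul0r// gt_eqF.
  by rewrite -powRD ?fn0 ?implybT// subrK powRr1.
have -> : f x * f (y + h) = f x `^ (1 - l) * f (y + h) `^ l * (f x `^ l * f (y + h) `^ (1 - l)).
  by rewrite [in LHS](pE x) [in LHS](pE (y + h)); ring.
by apply: ler_pM => //; rewrite mulr_ge0 ?powR_ge0.
Qed.

Lemma lcd_quasiconcave x y z c : x <= z -> z <= y -> c <= f x -> c <= f y -> 0 <= c -> c <= f z.
Proof.
move=> xz zy cx cy c0.
have [->//|zx] := eqVneq z x.
have [->//|zy'] := eqVneq z y.
have xz' : x < z by rewrite lt_neqAle eq_sym zx.
have zy2 : z < y by rewrite lt_neqAle zy'.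
pose l := (z - x) / (y - x).
have d0 : 0 < y - x by lra.
have l0 : 0 < l by rewrite divr_gt0//; lra.
have l1 : l < 1 by rewrite ltr_pdivrMr//; lra.
have := lcd_concave lf x y l0 l1.
have -> : (1 - l) * x + l * y = z by rewrite /l; field; rewrite gt_eqF.
apply: le_trans.
have -> : c = c `^ (1 - l) * c `^ l.
  have [->|cn0] := eqVneq c 0; first by rewrite powR0 ?mul0r// gt_eqF//; lra.
  by rewrite -powRD ?cn0 ?implybT// subrK powRr1.
by apply: ler_pM; rewrite ?powR_ge0//; apply: ge0_ler_powR => //; rewrite ?nnegrE//; lra.
Qed.

(** Otherwise [f] would be at least [f t0 / 4] on a whole interval of length [s = 8 / f t0], which
    would carry mass 2. *)
Lemma lcd_decay t0 s : s = 8 / f t0 -> 0 < f t0 ->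
  f (t0 + s) <= f t0 / 4 /\ f (t0 - s) <= f t0 / 4.
Proof.
move=> sE ft0.
have s0 : 0 < s by rewrite sE divr_gt0.
have key a : (forall z, a <= z -> z <= a + s -> f t0 / 4 <= f z) -> False.
  move=> h.
  have : (1%:E < \int[mu]_x (f x)%:E)%E.
    apply: (@lt_le_trans _ _ (\int[mu]_(x in `[a, (a + s)%R]) (f t0 / 4)%:E)%E).
      rewrite integral_cst//= lebesgue_measure_itv/= lte_fin ltrDl s0 -EFinB -EFinM lte_fin.
      rewrite (_ : f t0 / 4 * (a + s - a) = 2); last by rewrite sE; field; rewrite gt_eqF.
      lra.
    rewrite integral_mkcond; apply: ge0_le_integral => //.
    - move=> x _; rewrite patchE; case: ifP => // _; rewrite lee_fin divr_ge0//; lra.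
    - by apply/(measurable_restrictT _ _).1.
    - exact/measurable_EFinP.
    - move=> x _; rewrite patchE; case: ifPn; last by rewrite lee_fin.
      by rewrite inE/= in_itv/= lee_fin => /andP[]; exact: h.
  by rewrite (lcd_mass lf) ltxx.
split; rewrite leNgt; apply/negP => ft1.
  apply: (key t0) => z z0 z1.
  apply: (lcd_quasiconcave z0 z1) => //; [lra|exact: ltW|lra].
apply: (key (t0 - s)) => z z0 z1; rewrite subrK in z1.
apply: (lcd_quasiconcave z0 z1) => //; [exact: ltW|lra|lra].
Qed.

Lemma lcd_integralZ (a : R) : 0 <= a ->
  (\int[mu]_x (a * f x)%:E = a%:E)%E.
Proof.
move=> a0; under eq_integral do rewrite EFinM.
rewrite ge0_integralZl_EFin ?(lcd_mass lf) ?mule1//.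
- by move=> x _; rewrite lee_fin.
- exact/measurable_EFinP.
Qed.

Lemma lcd_second_moment_fin t0 : (\int[mu]_x ((x - t0) ^+ 2 * f x)%:E < +oo)%E.
Proof.
pose K := (`|M| + `|t0|) ^+ 2.
apply: (@le_lt_trans _ _ (\int[mu]_x (K * f x)%:E)%E); last first.
  by rewrite lcd_integralZ ?ltry// sqr_ge0.
apply: ge0_le_integral => //.
- by move=> x _; rewrite lee_fin mulr_ge0// sqr_ge0.
- apply/measurable_EFinP; apply: measurable_funM => //.
  by apply: measurable_funX; apply: measurable_funB.
- by apply/measurable_EFinP; apply: measurable_funM.
- move=> x _; rewrite lee_fin.
  have [xM|xM] := ltP `|x| M; last by rewrite (lcd_support lf)// !mulr0.
  rewrite ler_wpM2r// -ler_sqrt ?sqr_ge0// !sqrtr_sqr.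
  rewrite [leRHS]ger0_norm ?addr_ge0//.
  by apply: (le_trans (ler_normB _ _)); rewrite lerD2r (le_trans (ltW xM))// ler_norm.
Qed.

(* With [s = 8 / f t0], log-concavity makes [f] drop by a factor [4] on each step of
   length [s] away from [t0], so the second moment [V] at [t0] satisfies
   [V <= 2 s^2 + V / 2]. *)
Lemma lcd_variance t0 : 0 < f t0 ->
  (\int[mu]_x ((x - t0) ^+ 2 * f x)%:E <= (256 / f t0 ^+ 2)%:E)%E.
Proof.
move=> ft0; have [s sE] : exists s, s = 8 / f t0 by exists (8 / f t0).
have s0 : 0 < s by rewrite sE divr_gt0.
have [dr dl] := lcd_decay sE ft0.
pose psi x := (x - t0) ^+ 2 * f x.
pose pr x := if t0 <= x then psi x else 0.
pose pl x := if t0 <= x then 0 else psi x.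
have mpsi : measurable_fun setT psi.
  apply: measurable_funM => //.
  by apply: measurable_funX; apply: measurable_funB.
have mle : measurable_fun setT (fun x : measurableTypeR R => t0 <= x).
  exact: measurable_fun_ler.
have mpr : measurable_fun setT (pr : measurableTypeR R -> R).
  by apply: measurable_fun_if => //; exact: measurable_funS mpsi.
have mpl : measurable_fun setT (pl : measurableTypeR R -> R).
  by apply: measurable_fun_if => //; exact: measurable_funS mpsi.
have psi0 x : 0 <= psi x by rewrite mulr_ge0 ?sqr_ge0.
have pr0 x : 0 <= pr x by rewrite /pr; case: ifP.
have pl0 x : 0 <= pl x by rewrite /pl; case: ifP.
have hr u : t0 <= u -> f (u + s) <= f u / 4.
  move=> u0; rewrite -(ler_pM2l ft0); apply: le_trans (lcd_swap u0 (ltW s0)) _.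
  by rewrite (_ : f t0 * (f u / 4) = f t0 / 4 * f u) ?ler_wpM2r//; field.
have hl u : u <= t0 -> f (u - s) <= f u / 4.
  move=> u0; have := @lcd_swap (u - s) (t0 - s) s; rewrite !subrK lerD2r.
  move=> /(_ u0 (ltW s0)) h; rewrite -(ler_pM2l ft0) mulrC; apply: le_trans h _.
  by rewrite (_ : f t0 * (f u / 4) = f u * (f t0 / 4)) ?ler_wpM2l//; field.
(* Beyond distance [s] on the right, [f x <= f (x - s) / 4] and
   [(x - t0)^2 <= 2 (x - s - t0)^2 + 2 s^2]; on the left likewise with [x + s]. Within distance [s],
   [(x - t0)^2 <= s^2]. Splitting [psi] into its halves [pr] and [pl] ensures that the shifted terms
   add up to [psi / 2] only after integration, not to twice that. *)
have pt x : psi x <= s ^+ 2 * f x + (2^-1 * pr (x - s) + s ^+ 2 / 2 * f (x - s))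
    + (2^-1 * pl (x + s) + s ^+ 2 / 2 * f (x + s)).
  have A0 : 0 <= s ^+ 2 * f x by rewrite mulr_ge0// sqr_ge0.
  have B0 : 0 <= 2^-1 * pr (x - s) by rewrite mulr_ge0.
  have C0 : 0 <= s ^+ 2 / 2 * f (x - s) by rewrite mulr_ge0// divr_ge0// sqr_ge0.
  have D0 : 0 <= 2^-1 * pl (x + s) by rewrite mulr_ge0.
  have E0 : 0 <= s ^+ 2 / 2 * f (x + s) by rewrite mulr_ge0// divr_ge0// sqr_ge0.
  have [xr|xr] := leP (t0 + s) x.
    have h := hr (x - s); rewrite subrK in h.
    have {}h : f x <= f (x - s) / 4 by apply: h; lra.
    suff : psi x <= 2^-1 * pr (x - s) + s ^+ 2 / 2 * f (x - s) by lra.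
    rewrite /pr ifT; last by lra.
    rewrite /psi; apply: (@le_trans _ _ ((x - t0) ^+ 2 * (f (x - s) / 4))).
      by rewrite ler_wpM2l// sqr_ge0.
    suff : 0 <= ((x - s - t0) - s) ^+ 2 * f (x - s) by lra.
    by rewrite mulr_ge0// sqr_ge0.
  have [xl|xl] := ltP x (t0 - s).
    have h := hl (x + s); rewrite addrK in h.
    have {}h : f x <= f (x + s) / 4 by apply: h; lra.
    suff : psi x <= 2^-1 * pl (x + s) + s ^+ 2 / 2 * f (x + s) by lra.
    rewrite /pl ifF; last by apply/negbTE; rewrite -ltNge; lra.
    rewrite /psi; apply: (@le_trans _ _ ((x - t0) ^+ 2 * (f (x + s) / 4))).
      by rewrite ler_wpM2l// sqr_ge0.
    suff : 0 <= ((x + s - t0) + s) ^+ 2 * f (x + s) by lra.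
    by rewrite mulr_ge0// sqr_ge0.
  suff : psi x <= s ^+ 2 * f x by lra.
  rewrite /psi ler_wpM2r// -ler_sqrt ?sqr_ge0// !sqrtr_sqr [leRHS]gtr0_norm//.
  by rewrite ler_norml; lra.
have mshift (g : measurableTypeR R -> R) a : measurable_fun setT g ->
    measurable_fun setT (fun x : measurableTypeR R => g (x + a)).
  move=> mg; have ma : measurable_fun setT (fun x : measurableTypeR R => x + a :
    measurableTypeR R).
    exact: measurable_funD.
  exact: (measurableT_comp mg ma).
have psiE : (\int[mu]_x (psi x)%:E = \int[mu]_x (pr x)%:E + \int[mu]_x (pl x)%:E)%E.
  rewrite -ge0_integralD_real//; apply: eq_integral => x _.
  by rewrite /pr /pl; case: ifP => _; rewrite ?addr0 ?add0r.
(* Absorbing half of the second moment into the left-hand side is legitimate only because it is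
   finite. *)
have psifin : (\int[mu]_x (psi x)%:E)%E \is a fin_num.
  rewrite ge0_fin_numE; first exact: lcd_second_moment_fin.
  by apply: integral_ge0 => x _; rewrite lee_fin.
have prfin : (\int[mu]_x (pr x)%:E)%E \is a fin_num.
  by move: psifin; rewrite psiE fin_numD => /andP[].
have plfin : (\int[mu]_x (pl x)%:E)%E \is a fin_num.
  by move: psifin; rewrite psiE fin_numD => /andP[].
have c1 : 0 <= s ^+ 2 by rewrite sqr_ge0.
have c2 : 0 <= s ^+ 2 / 2 by rewrite divr_ge0.
have c3 : 0 <= 2^-1 :> R by [].
have h : (\int[mu]_x (psi x)%:E <= (s ^+ 2)%:E + ((2^-1)%:E * \int[mu]_x (pr x)%:E + (s ^+ 2 /
  2)%:E)
   + ((2^-1)%:E * \int[mu]_x (pl x)%:E + (s ^+ 2 / 2)%:E))%E.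
  have m1 := mshift _ (- s) mpr; have m2 := mshift _ s mpl.
  have m3 := mshift _ (- s) mf; have m4 := mshift _ s mf.
  have m5 : measurable_fun setT (fun x : measurableTypeR R => 2^-1 * pr (x - s)).
    exact: measurable_funM.
  have m6 : measurable_fun setT (fun x : measurableTypeR R => 2^-1 * pl (x + s)).
    exact: measurable_funM.
  have m7 : measurable_fun setT (fun x : measurableTypeR R => s ^+ 2 / 2 * f (x - s)).
    exact: measurable_funM.
  have m8 : measurable_fun setT (fun x : measurableTypeR R => s ^+ 2 / 2 * f (x + s)).
    exact: measurable_funM.
  have m9 : measurable_fun setT (fun x : measurableTypeR R => s ^+ 2 * f x).
    exact: measurable_funM.
  have i2 : (\int[mu]_x (s ^+ 2 / 2 * f (x - s))%:E = (s ^+ 2 / 2)%:E)%E.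
    by rewrite (ge0_integralZ_real mu (f := fun x => f (x - s)))// ge0_integral_shift//
      (lcd_mass lf) mule1.
  have i4 : (\int[mu]_x (s ^+ 2 / 2 * f (x + s))%:E = (s ^+ 2 / 2)%:E)%E.
    by rewrite (ge0_integralZ_real mu (f := fun x => f (x + s)))// ge0_integral_shift//
      (lcd_mass lf) mule1.
  have i1 : (\int[mu]_x (2^-1 * pr (x - s))%:E = (2^-1)%:E * \int[mu]_x (pr x)%:E)%E.
    by rewrite (ge0_integralZ_real mu (f := fun x => pr (x - s)))// ge0_integral_shift.
  have i3 : (\int[mu]_x (2^-1 * pl (x + s))%:E = (2^-1)%:E * \int[mu]_x (pl x)%:E)%E.
    by rewrite (ge0_integralZ_real mu (f := fun x => pl (x + s)))// ge0_integral_shift.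
  rewrite -(lcd_integralZ c1) -{1}i2 -{1}i4 -i1 -i3.
  have n1 x : 0 <= 2^-1 * pr (x - s) by rewrite mulr_ge0.
  have n2 x : 0 <= s ^+ 2 / 2 * f (x - s) by rewrite mulr_ge0.
  have n3 x : 0 <= 2^-1 * pl (x + s) by rewrite mulr_ge0.
  have n4 x : 0 <= s ^+ 2 / 2 * f (x + s) by rewrite mulr_ge0.
  have n5 x : 0 <= s ^+ 2 * f x by rewrite mulr_ge0.
  have nr x : 0 <= 2^-1 * pr (x - s) + s ^+ 2 / 2 * f (x - s) by rewrite addr_ge0.
  have nl x : 0 <= 2^-1 * pl (x + s) + s ^+ 2 / 2 * f (x + s) by rewrite addr_ge0.
  have nn x : 0 <= s ^+ 2 * f x + (2^-1 * pr (x - s) + s ^+ 2 / 2 * f (x - s)) by rewrite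
    addr_ge0.
  have mr := measurable_funD m5 m7; have ml := measurable_funD m6 m8.
  have mn := measurable_funD m9 mr.
  rewrite -(ge0_integralD_real mu m5 n1 m7 n2) -(ge0_integralD_real mu m6 n3 m8 n4)
    -(ge0_integralD_real mu m9 n5 mr nr) -(ge0_integralD_real mu mn nn ml nl).
  apply: ge0_le_integral => //.
  - by move=> x _; rewrite lee_fin.
  - exact/measurable_EFinP.
  - apply/measurable_EFinP; exact: measurable_funD mn ml.
  - by move=> x _; rewrite lee_fin.
rewrite -[X in (X <= _)%E](fineK psifin) -{1}(fineK prfin) -{1}(fineK plfin) in h.
have e : fine (\int[mu]_x (psi x)%:E) = fine (\int[mu]_x (pr x)%:E) + fine (\int[mu]_x (pl
  x)%:E).
  by rewrite psiE fineD.
rewrite -/psi -(fineK psifin) lee_fin.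
have -> : 256 / f t0 ^+ 2 = 4 * s ^+ 2 by rewrite sE; field; rewrite gt_eqF.
move: h; rewrite -!EFinM -!EFinD lee_fin e.
lra.
Qed.

End log_concave.

(** * The distribution function of a log-concave density *)

Section distribution_function.
Context {R : realType}.
Local Notation mu := (@lebesgue_measure R).
Variables (M : R) (f : measurableTypeR R -> R).
Hypothesis lf : log_concave_density M f.

Let mf := lcd_measurable lf.
Let f0 x : 0 <= f x. Proof. by have [B fB] := lcd_bounded lf; case/andP: (fB x). Qed.

(** A truncation on the whole line rather than an integral over a half-line, so that
    Prékopa-Leindler applies to it directly. The strict inequality makes it complementary to closed
    half-spaces. *)
Definition cut (x : R) (u : measurableTypeR R) : R := if u < x then f u else 0.

Definition lcd_cdf (x : R) : R := fine (\int[mu]_u (cut x u)%:E).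

Lemma measurable_cut x : measurable_fun setT (cut x).
Proof.
apply: measurable_fun_if => //; first exact: measurable_fun_ltr.
exact: measurable_funS mf.
Qed.

Lemma cut_ge0 x u : 0 <= cut x u. Proof. by rewrite /cut; case: ifP. Qed.

Lemma cut_le x u : cut x u <= f u. Proof. by rewrite /cut; case: ifP. Qed.

Lemma integral_cut_le1 x : (\int[mu]_u (cut x u)%:E <= 1)%E.
Proof.
rewrite -(lcd_mass lf); apply: ge0_le_integral_real => //.
- exact: measurable_cut.
- exact: cut_ge0.
- exact: cut_le.
Qed.

Lemma lcd_cdfE x : (\int[mu]_u (cut x u)%:E = (lcd_cdf x)%:E)%E.
Proof.
rewrite fineK// ge0_fin_numE.
  by apply: le_lt_trans (integral_cut_le1 x) _; rewrite ltry.
by apply: integral_ge0 => u _; rewrite lee_fin cut_ge0.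
Qed.

Lemma lcd_cdf_ge0 x : 0 <= lcd_cdf x.
Proof.
by rewrite -lee_fin -lcd_cdfE; apply: integral_ge0 => u _; rewrite lee_fin cut_ge0.
Qed.

Lemma lcd_cdf_le1 x : lcd_cdf x <= 1.
Proof. by rewrite -lee_fin -lcd_cdfE integral_cut_le1. Qed.

Lemma lcd_cdf_nondecreasing x y : x <= y -> lcd_cdf x <= lcd_cdf y.
Proof.
move=> xy; rewrite -lee_fin -!lcd_cdfE; apply: ge0_le_integral_real.
- exact: measurable_cut.
- exact: measurable_cut.
- exact: cut_ge0.
- move=> u; rewrite {1}/cut; case: ifPn => [ux|_]; last exact: cut_ge0.
  by rewrite /cut (lt_le_trans ux xy).
Qed.

Lemma lcd_cdf_increment x y B : x <= y -> (forall u, x <= u -> u < y -> f u <= B) -> 0 <= B ->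
  lcd_cdf y - lcd_cdf x <= B * (y - x).
Proof.
move=> xy fB B0; rewrite lerBlDl -lee_fin EFinD -!lcd_cdfE.
pose g u := if (x <= u) && (u < y) then B else 0.
have mg : measurable_fun setT (g : measurableTypeR R -> R).
  apply: measurable_fun_if => //; apply: measurable_and.
    exact: measurable_fun_ler.
  exact: measurable_fun_ltr.
have g0 u : 0 <= g u by rewrite /g; case: ifP.
have <- : (\int[mu]_u (g u)%:E = (B * (y - x))%:E)%E.
  transitivity (\int[mu]_(u in `[x, y[) B%:E)%E.
    rewrite [RHS]integral_mkcond; apply: eq_integral => u _.
    by rewrite patchE mem_setE in_itv/= /g; case: ifP.
  rewrite integral_cst//= lebesgue_measure_itv/= lte_fin.
  have [xy'|yx] := ltP x y; first by rewrite -EFinB -EFinM.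
  by rewrite (le_anti (introT andP (conj xy yx))) subrr mulr0 mule0.
rewrite -ge0_integralD_real//; [|exact: measurable_cut|exact: cut_ge0].
apply: ge0_le_integral_real.
- exact: measurable_cut.
- by apply: measurable_funD => //; exact: measurable_cut.
- exact: cut_ge0.
- move=> u; rewrite /cut /g; have [ux|xu] := ltP u x.
    by rewrite (lt_le_trans ux xy) addr0.
  by rewrite add0r /=; case: ifPn => // uy; exact: fB.
Qed.

Lemma lcd_cdf0 x : x <= - M -> lcd_cdf x = 0.
Proof.
move=> xM; rewrite /lcd_cdf integral0_eq// => u _; rewrite /cut; case: ifPn => // ux.
rewrite (lcd_support lf)//.
have h : u <= - M by exact: ltW (lt_le_trans ux xM).
by rewrite -normrN (le_trans _ (ler_norm (- u)))// lerNr.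
Qed.

Lemma lcd_cdf1 x : M <= x -> lcd_cdf x = 1.
Proof.
move=> xM; rewrite /lcd_cdf (eq_integral (fun u => (f u)%:E)) ?(lcd_mass lf)// => u _.
rewrite /cut; case: ifPn => //; rewrite -leNgt => ux.
by rewrite (lcd_support lf)// (le_trans _ (ler_norm u))// (le_trans xM).
Qed.

(** Prékopa-Leindler for the truncations: if [u < x] and [v < y], the combination of [u] and [v]
    lies below that of [x] and [y], where log-concavity of [f] gives the bound. *)
Lemma lcd_cdf_log_concave l x y : 0 < l -> l < 1 ->
  lcd_cdf x `^ (1 - l) * lcd_cdf y `^ l <= lcd_cdf ((1 - l) * x + l * y).
Proof.
move=> l0 l1; rewrite -lee_fin -lcd_cdfE.
have [B fB] := lcd_bounded lf.
have cB z u : 0 <= cut z u <= B.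
  by rewrite cut_ge0 (le_trans (cut_le z u))//; case/andP: (fB u).
apply: (@prekopa_leindler R l _ _ B (cut x) (cut y)) => //; try exact: measurable_cut.
- exact: cut_ge0.
- move=> u v; rewrite {1}/cut; case: ifPn => [ux|_]; last first.
    by rewrite powR0 ?mul0r ?cut_ge0// gt_eqF//; lra.
  rewrite {1}/cut; case: ifPn => [vy|_]; last by rewrite powR0 ?mulr0 ?cut_ge0// gt_eqF.
  rewrite /cut ifT; last first.
    by apply: ltrD; rewrite ltr_pM2l//; lra.
  exact: (lcd_concave lf).
- exact: lcd_cdfE.
- exact: lcd_cdfE.
Qed.

Lemma lcd_cdf_continuous : continuous lcd_cdf.
Proof.
have [B fB] := lcd_bounded lf.
have B0 : 0 <= B by case/andP: (fB 0) => h1 h2; exact: le_trans h2.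
have lip x y : x <= y -> lcd_cdf y - lcd_cdf x <= B * (y - x).
  by move=> xy; apply: lcd_cdf_increment => // u _ _; case/andP: (fB u).
move=> x; apply/cvgrPdist_le => /= e e0.
near=> y.
have h : `|x - y| <= e / (B + 1).
  near: y.
  have e' : 0 < e / (B + 1) by rewrite divr_gt0//; lra.
  have := @cvgrPdist_le _ R _ (nbhs x) _ id x.
  by case=> /(_ (@cvg_id _ _)) /(_ _ e').
apply: (@le_trans _ _ (B * `|x - y|)).
  have [xy|yx] := leP x y.
    rewrite ler0_norm ?subr_le0 ?lcd_cdf_nondecreasing// opprB.
    by rewrite ler0_norm ?subr_le0// opprB lip.
  have yx' := ltW yx.
  rewrite ger0_norm ?subr_ge0 ?lcd_cdf_nondecreasing//.
  by rewrite ger0_norm ?subr_ge0// lip.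
apply: (@le_trans _ _ ((B + 1) * (e / (B + 1)))).
  by apply: ler_pM => //; lra.
by rewrite mulrC divfK// gt_eqF//; lra.
Unshelve. all: by end_near. Qed.

End distribution_function.

(** * Grünbaum's inequality *)

Section gruenbaum.
Context {R : realType}.
Local Notation mu := (@lebesgue_measure R).

Lemma integral_exp_le (a b c : R) : 0 < a -> b < c ->
  (\int[mu]_(x in `[b, c]) (expR (a * (x - c)))%:E <= (a^-1)%:E)%E.
Proof.
move=> a0 bc; pose G x := a^-1 * expR (a * (x - c)).
have dG x : is_derive x (1:R) G (expR (a * (x - c))).
  rewrite /G; apply: is_derive_eq.
  rewrite /GRing.scale/= !(mulr1, addr0, add0r, subr0, mulr0); field; exact: lt0r_neq0.
have cG : continuous G.
  by move=> x; apply: differentiable_continuous; apply/derivable1_diffP; exact: ex_derive.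
have ce : continuous (fun x => expR (a * (x - c))).
  move=> x; apply: continuous_comp; last exact: continuous_expR.
  apply: continuousM; first exact: cst_continuous.
  by apply: continuousB => //; exact: cst_continuous.
rewrite (@continuous_FTC2 _ _ G)//.
- rewrite /G subrr mulr0 expR0 mulr1 -EFinB lee_fin gerBl.
  by rewrite mulr_ge0 ?expR_ge0// invr_ge0 ltW.
- exact: continuous_subspaceT.
- split.
  + by move=> x _; exact: ex_derive.
  + by apply: cvg_at_right_filter; exact: cG.
  + by apply: cvg_at_left_filter; exact: cG.
- by move=> x _; rewrite derive1E; apply: derive_val.
Qed.

Variables (M : R) (f : measurableTypeR R -> R).
Hypothesis lf : log_concave_density M f.

Let mf := lcd_measurable lf.
Let f0 x : 0 <= f x. Proof. by have [B fB] := lcd_bounded lf; case/andP: (fB x). Qed.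
Local Notation F := (lcd_cdf f).

(** By log-concavity, each slope of [ln F] from [t] to the right is at most each slope from the
    left. The supremum of the right slopes therefore serves on both sides; it is positive because
    [F M = 1 > F t]. *)
Lemma lcd_cdf_supergradient t : 0 < F t -> F t < 1 ->
  exists2 a : R, 0 < a & forall x, F x <= F t * expR (a * (x - t)).
Proof.
move=> Ft0 Ft1.
have tM : t < M.
  by rewrite ltNge; apply/negP => /(lcd_cdf1 lf) h; rewrite h ltxx in Ft1.
have slopes x y : x < t -> t < y -> 0 < F x ->
    (ln (F y) - ln (F t)) / (y - t) <= (ln (F t) - ln (F x)) / (t - x).
  move=> xt ty Fx0.
  have Fy0 : 0 < F y by apply: lt_le_trans Ft0 _; apply: (lcd_cdf_nondecreasing lf); exact: ltW.
  have yx : 0 < y - x by lra.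
  pose l := (t - x) / (y - x).
  have l0 : 0 < l by rewrite divr_gt0//; lra.
  have l1 : l < 1 by rewrite ltr_pdivrMr//; lra.
  have := lcd_cdf_log_concave lf x y l0 l1.
  have -> : (1 - l) * x + l * y = t by rewrite /l; field; rewrite gt_eqF.
  rewrite -ler_ln ?posrE ?mulr_gt0 ?powR_gt0// lnM ?posrE ?powR_gt0// !ln_powR => h.
  rewrite ler_pdivrMr ?subr_gt0// mulrAC ler_pdivlMr ?subr_gt0//.
  have h2 : ((1 - l) * ln (F x) + l * ln (F y)) * (y - x) <= ln (F t) * (y - x).
    by rewrite ler_pM2r.
  have e : ((1 - l) * ln (F x) + l * ln (F y)) * (y - x) =
      (y - t) * ln (F x) + (t - x) * ln (F y).
    by rewrite /l; field; rewrite gt_eqF.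
  rewrite e in h2; nra.
have [B fB] := lcd_bounded lf.
have B0 : 0 <= B by case/andP: (fB 0) => h1 h2; exact: le_trans h2.
(* A left slope at a point where [F] is positive bounds the right slopes. As [F] has Lipschitz
   constant [B + 1], it loses at most half of [F t] over the chosen length. *)
have [x0 x0t Fx0] : exists2 x0, x0 < t & 0 < F x0.
  exists (t - F t / (2 * (B + 1))).
    by rewrite ltrBlDr ltrDl divr_gt0//; lra.
  have := @lcd_cdf_increment _ _ _ lf (t - F t / (2 * (B + 1))) t (B + 1).
  have -> : (B + 1) * (t - (t - F t / (2 * (B + 1)))) = F t / 2.
    by field; rewrite gt_eqF//; lra.
  move=> /(_ _ _ _) h.
  have : F t - F (t - F t / (2 * (B + 1))) <= F t / 2.
    apply: h; last by lra.
    - by rewrite lerBlDr lerDl divr_ge0//; lra.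
    - by move=> u _ _; case/andP: (fB u) => _; lra.
  lra.
pose S := [set (ln (F y) - ln (F t)) / (y - t) | y in [set y | t < y]].
have hs : has_sup S.
  split; first by exists ((ln (F M) - ln (F t)) / (M - t)); exists M.
  by exists ((ln (F t) - ln (F x0)) / (t - x0)) => _ [y ty <-]; exact: slopes.
have Sub y : t < y -> (ln (F y) - ln (F t)) / (y - t) <= sup S.
  by move=> ty; apply: ub_le_sup; [case: hs|exists y].
exists (sup S).
  apply: lt_le_trans (Sub M tM).
  rewrite divr_gt0 ?subr_gt0// (lcd_cdf1 lf (lexx M)).
  by rewrite ltr_ln ?posrE.
move=> x.
have [Fx|Fx_neq0] := eqVneq (F x) 0; first by rewrite Fx mulr_ge0 ?expR_ge0// ltW.
have Fx_gt0 : 0 < F x by rewrite lt_neqAle eq_sym Fx_neq0 (lcd_cdf_ge0 lf).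
rewrite -ler_ln ?posrE ?mulr_gt0 ?expR_gt0// lnM ?posrE ?expR_gt0// expRK -lerBlDl.
have [xt|tx|->] := ltgtP x t; last by rewrite !subrr mulr0.
  have : sup S <= (ln (F t) - ln (F x)) / (t - x).
    by apply: ge_sup; [case: hs|move=> _ [y ty <-]; exact: slopes].
  rewrite ler_pdivlMr ?subr_gt0//; lra.
by have := Sub x tx; rewrite ler_pdivrMr ?subr_gt0.
Qed.

(* [f] has barycenter [0]; the integrand is nonnegative on the support of [f]. *)
Hypothesis mean : (\int[mu]_u ((M - u) * f u)%:E = M%:E)%E.

(** An integration by parts done by Tonelli: in the region [u < x], [-M <= x <= M], the slice over
    [u] in the support has length [M - u]. *)
Lemma integral_lcd_cdf : (\int[mu]_(x in `[(- M)%R, M]) (F x)%:E = M%:E)%E.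
Proof.
pose g (p : measurableTypeR R * measurableTypeR R) : R :=
  if (- M <= p.1) && (p.1 <= M) && (p.2 < p.1) then f p.2 else 0.
have mg : measurable_fun setT g.
  apply: measurable_fun_if => //.
  - apply: measurable_and; first apply: measurable_and.
    + exact: measurable_fun_ler.
    + exact: measurable_fun_ler.
    + exact: measurable_fun_ltr.
  - apply: (@measurable_funS _ _ _ _ setT) => //.
    exact: measurableT_comp.
have g0 p : 0 <= g p by rewrite /g; case: ifP.
have := @fubini_tonelli _ _ _ _ R mu mu (EFin \o g).
move=> /(_ _ _) h.
have {}h : (\int[mu]_x \int[mu]_u (g (x, u))%:E = \int[mu]_u \int[mu]_x (g (x, u))%:E)%E.
  apply: h; first exact/measurable_EFinP.
  by move=> p /=; rewrite lee_fin.
transitivity (\int[mu]_x \int[mu]_u (g (x, u))%:E)%E.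
  rewrite integral_mkcond; apply: eq_integral => x _.
  rewrite patchE mem_setE in_itv/= /g/=; case: ifPn => xM.
    by rewrite -(lcd_cdfE lf).
  by rewrite integral0_eq.
rewrite h -mean; apply: eq_integral => u _.
have [uM|uM] := leP M `|u|.
  rewrite (lcd_support lf uM) mulr0 integral0_eq// => x _.
  by rewrite /g/= (lcd_support lf uM); case: ifP.
have /andP[u1 u2] : (- M < u) && (u < M) by rewrite -ltr_norml.
transitivity (\int[mu]_(x in `]u, M]) (f u)%:E)%E.
  rewrite [RHS]integral_mkcond; apply: eq_integral => x _.
  rewrite patchE mem_setE in_itv/= /g/=.
  have [ux|xu] := ltP u x; last by rewrite andbF.
  by rewrite andbT/= (ltW (lt_trans u1 ux))/=; case: ifP.
rewrite integral_cst//= lebesgue_measure_itv/= lte_fin u2 -EFinB -EFinM.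
by rewrite mulrC.
Qed.

(* Compare [integral_lcd_cdf] with the integral of [min 1 (expR (a * (x - x0)))], where
   [F t * expR (a * (x - t)) = expR (a * (x - x0))]. *)
Lemma gruenbaum_slope t a : 0 < F t -> 0 < a ->
  (forall x, F x <= F t * expR (a * (x - t))) -> t <= (1 + ln (F t)) / a.
Proof.
move=> Ft0 a0 Fa; pose x0 := t - ln (F t) / a.
have aE x : F t * expR (a * (x - t)) = expR (a * (x - x0)).
  rewrite -{1}(lnK Ft0) -expRD; congr expR; rewrite /x0; field; exact: lt0r_neq0.
have tM : - M < t.
  by rewrite ltNge; apply/negP => /(lcd_cdf0 lf) h; rewrite h ltxx in Ft0.
have tx0 : t <= x0.
  by rewrite /x0 lerBrDr gerDl mulr_le0_ge0 ?invr_ge0 ?(ltW a0)// ln_le0// (lcd_cdf_le1 lf).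
have x0M : x0 <= M.
  rewrite leNgt; apply/negP => Mx0.
  have := Fa M; rewrite aE (lcd_cdf1 lf)// leNgt => /negP; apply.
  by rewrite expR_lt1 pmulr_rlt0// subr_lt0.
(* At [x0] the exponential bound reaches 1. Up to [x0] its integral is at most [1 / a], and from
   [x0] to [M] the bound [F <= 1] contributes [M - x0]; the sum is at least [M]. *)
suff : x0 <= a^-1.
  by rewrite /x0 lerBlDr mulrDl mul1r.
have Mx0 : - M < x0 by exact: lt_le_trans tx0.
pose h1 : measurableTypeR R -> R := (fun x => expR (a * (x - x0))) \_ `[- M, x0].
pose h2 : measurableTypeR R -> R := (fun=> 1 : R) \_ `[x0, M].
have m1 : measurable_fun setT h1.
  apply/(measurable_restrictT _ _).1 => //; apply: measurable_funTS.
  apply: measurableT_comp => //; apply: measurable_funM => //.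
  exact: measurable_funB.
have m2 : measurable_fun setT h2 by apply/(measurable_restrictT _ _).1.
have h10 x : 0 <= h1 x by rewrite /h1 patchE; case: ifP => // _; exact: expR_ge0.
have h20 x : 0 <= h2 x by rewrite /h2 patchE; case: ifP => // _.
have mF : measurable_fun setT (F : measurableTypeR R -> R).
  by apply: continuous_measurable_fun; exact: (lcd_cdf_continuous lf).
have : (\int[mu]_(x in `[(- M)%R, M]) (F x)%:E <= \int[mu]_x (h1 x + h2 x)%:E)%E.
  rewrite integral_mkcond; apply: ge0_le_integral => //.
  - by move=> x _; rewrite patchE; case: ifP => // _; rewrite lee_fin (lcd_cdf_ge0 lf).
  - apply/(measurable_restrictT _ _).1 => //; apply: measurable_funTS.
    exact/measurable_EFinP.
  - by apply/measurable_EFinP; exact: measurable_funD.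
  - move=> x _; rewrite patchE mem_setE in_itv/=.
    case: ifPn => [/andP[xM Mx]|_]; last by rewrite lee_fin addr_ge0.
    rewrite lee_fin /h1 /h2 !patchE !mem_setE !in_itv/= xM Mx andbT/=.
    have [xx0|x0x] := leP x x0.
      by rewrite (le_trans (Fa x))// aE lerDl; case: ifP.
    by rewrite (ltW x0x) add0r (lcd_cdf_le1 lf).
rewrite integral_lcd_cdf ge0_integralD_real//.
have -> : (\int[mu]_x (h2 x)%:E = (M - x0)%:E)%E.
  transitivity (\int[mu]_(x in `[x0, M]) 1%:E)%E.
    rewrite [RHS]integral_mkcond; apply: eq_integral => x _.
    by rewrite /h2 !patchE; case: ifP.
  rewrite integral_cst//= lebesgue_measure_itv/= lte_fin mul1e.
  have [//|Mx0'] := ltP x0 M; rewrite (le_anti (introT andP (conj x0M Mx0'))) subrr//.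
have -> : (\int[mu]_x (h1 x)%:E = \int[mu]_(x in `[(- M)%R, x0]) (expR (a * (x - x0)))%:E)%E.
  rewrite [RHS]integral_mkcond; apply: eq_integral => x _.
  by rewrite /h1 !patchE; case: ifP.
move=> h; have := le_trans h (leeD (integral_exp_le a0 Mx0) (lexx _)).
rewrite -EFinD lee_fin; lra.
Qed.

End gruenbaum.

Section gruenbaum_quantile.
Context {R : realType}.
Local Notation mu := (@lebesgue_measure R).
Variables (M : R) (f : measurableTypeR R -> R).
Hypothesis lf : log_concave_density M f.
Hypothesis M0 : 0 < M.
Hypothesis mean : (\int[mu]_u ((M - u) * f u)%:E = M%:E)%E.

Let mf := lcd_measurable lf.
Let f0 x : 0 <= f x. Proof. by have [B fB] := lcd_bounded lf; case/andP: (fB x). Qed.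
Local Notation F := (lcd_cdf f).

(** Since [f] has mean 0, the second moment about [c] is the one about 0 plus [c ^+ 2]. It lets the
    variance bound, which is centered at the point where [f] is evaluated, control the second moment
    about 0. *)
Lemma lcd_second_moment_le c :
  (\int[mu]_u (u ^+ 2 * f u)%:E <= \int[mu]_u ((u - c) ^+ 2 * f u)%:E)%E.
Proof.
have mp (p : R -> R) : measurable_fun setT (p : measurableTypeR R -> R) ->
    measurable_fun setT (fun u : measurableTypeR R => p u * f u).
  by move=> h; exact: measurable_funM.
have msq k : measurable_fun setT (fun u : measurableTypeR R => (u - k) ^+ 2 * f u).
  by apply: (mp (fun u => (u - k) ^+ 2)); apply: measurable_funX; exact: measurable_funB.
have msq0 : measurable_fun setT (fun u : measurableTypeR R => u ^+ 2 * f u).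
  by apply: (mp (fun u => u ^+ 2)); exact: measurable_funX.
have mM : measurable_fun setT (fun u : measurableTypeR R => (M - u) * f u).
  by apply: (mp (fun u => M - u)); exact: measurable_funB.
have sq0 k u : 0 <= (u - k) ^+ 2 * f u by rewrite mulr_ge0// sqr_ge0.
have sq00 u : 0 <= u ^+ 2 * f u by rewrite mulr_ge0// sqr_ge0.
have Mu0 u : 0 <= (M - u) * f u.
  have [uM|uM] := leP M `|u|; first by rewrite (lcd_support lf uM) mulr0.
  by rewrite mulr_ge0// subr_ge0 (le_trans (ler_norm u))// ltW.
have fin (k : R) : (\int[mu]_u ((u - k) ^+ 2 * f u)%:E)%E \is a fin_num.
  rewrite ge0_fin_numE; first exact: lcd_second_moment_fin lf k.
  by apply: integral_ge0 => u _; rewrite lee_fin.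
have e0 : (\int[mu]_u (u ^+ 2 * f u)%:E = \int[mu]_u ((u - 0) ^+ 2 * f u)%:E)%E.
  by apply: eq_integral => u _; rewrite subr0.
set I := (\int[mu]_u ((u - c) ^+ 2 * f u)%:E)%E; set V := (\int[mu]_u (u ^+ 2 * f u)%:E)%E.
have Ifin : I \is a fin_num by exact: fin.
have Vfin : V \is a fin_num by rewrite /V e0; exact: fin.
have mfZ k : measurable_fun setT (fun u : measurableTypeR R => k * f u).
  exact: (mp (fun=> k)).
have mMZ k : measurable_fun setT (fun u : measurableTypeR R => k * ((M - u) * f u)).
  exact: measurable_funM.
have fZ0 k u : 0 <= k -> 0 <= k * f u by move=> k0; rewrite mulr_ge0.
have MZ0 k u : 0 <= k -> 0 <= k * ((M - u) * f u) by move=> k0; rewrite mulr_ge0.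
have addfZ (g : measurableTypeR R -> R) k : measurable_fun setT g -> (forall u, 0 <= g u) -> 0
  <= k ->
    (\int[mu]_u (g u + k * f u)%:E = \int[mu]_u (g u)%:E + k%:E)%E.
  move=> mg g0 k0; rewrite (ge0_integralD_real mu mg g0 (mfZ k)).
    by rewrite (lcd_integralZ lf k0).
  by move=> u; exact: fZ0.
have addMZ (g : measurableTypeR R -> R) k : measurable_fun setT g -> (forall u, 0 <= g u) -> 0
  <= k ->
    (\int[mu]_u (g u + k * ((M - u) * f u))%:E = \int[mu]_u (g u)%:E + (k * M)%:E)%E.
  move=> mg g0 k0; rewrite (ge0_integralD_real mu mg g0 (mMZ k)).
    by rewrite (ge0_integralZ_real mu mM Mu0 k0) mean EFinM.
  by move=> u; exact: MZ0.
have cc0 : 0 <= c ^+ 2 by rewrite sqr_ge0.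
have mV : measurable_fun setT (fun u : measurableTypeR R => u ^+ 2 * f u + c ^+ 2 * f u).
  exact: measurable_funD.
have V0 u : 0 <= u ^+ 2 * f u + c ^+ 2 * f u by rewrite addr_ge0// fZ0.
(* [(u - c)^2 + 2cM = u^2 + c^2 + 2c(M - u)], written with nonnegative terms
   on both sides according to the sign of [c] *)
have [c0|c0] := leP 0 c.
  have c2 : 0 <= 2 * c by rewrite mulr_ge0.
  have c2M : 0 <= 2 * c * M by rewrite mulr_ge0// ltW.
  have h1 := addfZ _ _ (msq c) (sq0 c) c2M.
  have h2 := addMZ _ _ mV V0 c2.
  rewrite (addfZ _ _ msq0 sq00 cc0) in h2.
  have e : (\int[mu]_u ((u - c) ^+ 2 * f u + 2 * c * M * f u)%:E =
      \int[mu]_u (u ^+ 2 * f u + c ^+ 2 * f u + 2 * c * ((M - u) * f u))%:E)%E.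
    by apply: eq_integral => u _; congr _%:E; ring.
  move: e; rewrite h1 h2 -/I -/V -(fineK Ifin) -(fineK Vfin) -!EFinD => -[h].
  by rewrite lee_fin; lra.
have c2 : 0 <= - 2 * c by lra.
have c2M : 0 <= - 2 * c * M by rewrite mulr_ge0// ltW.
have h1 := addMZ _ _ (msq c) (sq0 c) c2.
have h2 := addfZ _ _ mV V0 c2M.
rewrite (addfZ _ _ msq0 sq00 cc0) in h2.
have e : (\int[mu]_u ((u - c) ^+ 2 * f u + - 2 * c * ((M - u) * f u))%:E =
    \int[mu]_u (u ^+ 2 * f u + c ^+ 2 * f u + - 2 * c * M * f u)%:E)%E.
  by apply: eq_integral => u _; congr _%:E; ring.
move: e; rewrite h1 h2 -/I -/V -(fineK Ifin) -(fineK Vfin) -!EFinD => -[h].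
by rewrite lee_fin; lra.
Qed.

(** Move right to a point [t'] with [F t' = delta] and take a slope [a] there. Some value of [f]
    exceeds [a delta / 4], so the variance bound gives [L <= 16 / (a delta / 4)], that is
    [1 / a >= L delta / 64]. The factor [1 + ln delta] in [t' <= (1 + ln delta) / a] is negative, so
    this lower bound on [1 / a] is the useful one. *)
Lemma gruenbaum_quantile (delta L t : R) : 0 < delta -> delta < expR (- 1) -> 0 < L ->
  (\int[mu]_u (u ^+ 2 * f u)%:E = (L ^+ 2)%:E)%E -> F t <= delta ->
  t <= (1 + ln delta) * (delta / 64) * L.
Proof.
move=> d0 d1 L0 VL Ft.
have e2 : expR (- 1) <= 2^-1 :> R.
  rewrite expRN lef_pV2 ?posrE ?expR_gt0//.
  by have := expR_ge1Dx (1 : R); lra.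
have d2 : delta < 1 by lra.
have [t' tt' Ft'] : exists2 t', t <= t' & F t' = delta.
  have [Mt|tM] := leP M t; first by move: Ft; rewrite (lcd_cdf1 lf Mt); lra.
  have cF : {within `[t, M], continuous F}.
    by apply: continuous_subspaceT; exact: (lcd_cdf_continuous lf).
  have dF : Num.min (F t) (F M) <= delta <= Num.max (F t) (F M).
    by rewrite (lcd_cdf1 lf (lexx M)) ge_min Ft/= le_max (ltW d2) orbT.
  have [c] := IVT (ltW tM) cF dF.
  by rewrite in_itv/= => /andP[tc _] Fc; exists c.
apply: le_trans tt' _.
have Ft0 : 0 < F t' by rewrite Ft'.
have Ft1 : F t' < 1 by rewrite Ft'.
have [a a0 Fa] := lcd_cdf_supergradient lf Ft0 Ft1.
have ai0 : 0 < a^-1 by rewrite invr_gt0.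
(* One has [F (t' - 1 / a) <= delta / e <= delta / 2], so [F] gains at least [delta / 2] over a
   length [1 / a]; values of [f] bounded by [a delta / 4] would allow only [delta / 4]. *)
have [t1 ft1] : exists t1, a * delta / 4 < f t1.
  apply: contrapT => /forallNP h.
  have : F t' - F (t' - a^-1) <= a * delta / 4 * (t' - (t' - a^-1)).
    apply: (lcd_cdf_increment lf).
    - by rewrite lerBlDr lerDl ltW.
    - by move=> u _ _; rewrite leNgt; apply/negP; exact: h.
    - by rewrite divr_ge0// mulr_ge0 ?ltW.
  have -> : a * delta / 4 * (t' - (t' - a^-1)) = delta / 4 by field; rewrite gt_eqF.
  have := Fa (t' - a^-1); rewrite Ft'.
  have -> : a * (t' - a^-1 - t') = -1 by field; rewrite gt_eqF.
  have : delta * expR (- 1) <= delta * 2^-1 by rewrite ler_wpM2l// ltW.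
  lra.
have ad0 : 0 < a * delta by rewrite mulr_gt0.
have f10 : 0 < f t1 by lra.
have : (\int[mu]_u (u ^+ 2 * f u)%:E <= (256 / f t1 ^+ 2)%:E)%E.
  exact: le_trans (lcd_second_moment_le t1) (lcd_variance lf f10).
rewrite VL lee_fin => hL.
have Lle : L <= 16 / f t1.
  rewrite -ler_sqr ?nnegrE ?divr_ge0 ?(ltW L0) ?(ltW f10)// expr_div_n.
  by have -> : 16 ^+ 2 = 256 :> R by ring.
have La : L * (a * delta) <= 64.
  have : L * f t1 <= 16 by rewrite -ler_pdivlMr.
  have : L * (a * delta / 4) <= L * f t1 by rewrite ler_wpM2l// ltW.
  lra.
have la : L * delta / 64 <= a^-1.
  rewrite -[leRHS]mul1r ler_pdivlMr//; lra.
have h := gruenbaum_slope lf mean Ft0 a0 Fa.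
rewrite Ft' in h; apply: le_trans h _.
have k0 : 1 + ln delta <= 0.
  have : ln delta < ln (expR (- 1)) by rewrite ltr_ln ?posrE ?expR_gt0.
  rewrite expRK; lra.
rewrite -mulrA; apply: ler_wnM2l => //; lra.
Qed.

End gruenbaum_quantile.

(** * Quadratic forms *)

Section quadratic_forms.
Context {R : realType}.

Definition qform n (A : 'M[R]_n) (x : 'rV[R]_n) : R := (x *m A *m x^T) 0 0.

Lemma qform1 n (x : 'rV[R]_n) : qform 1%:M x = dotv x x.
Proof. by rewrite /qform mulmx1 mxE; apply: eq_bigr => i _; rewrite mxE. Qed.

Lemma dotv_ge0 n (x : 'rV[R]_n) : 0 <= dotv x x.
Proof. by apply: sumr_ge0 => i _; rewrite -expr2 sqr_ge0. Qed.

Lemma dotv_gt0 n (x : 'rV[R]_n) : x != 0 -> 0 < dotv x x.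
Proof.
move=> x0; rewrite lt_neqAle dotv_ge0 andbT eq_sym; apply: contra_neq x0.
move=> /eqP; rewrite psumr_eq0; last by move=> i _; rewrite -expr2 sqr_ge0.
by move=> /allP h; apply/rowP => i; have := h i (mem_index_enum _); rewrite /= -expr2 sqrf_eq0
  mxE => /eqP.
Qed.

Lemma dotvE n (x y : 'rV[R]_n) : x *m y^T = (dotv x y)%:M.
Proof.
apply/matrixP => i j; rewrite !ord1 !mxE eqxx mulr1n.
by apply: eq_bigr => k _; rewrite mxE.
Qed.

Lemma qform_mul_tr n (M : 'M[R]_n) (x : 'rV[R]_n) : qform (M *m M^T) x = dotv (x *m M) (x *m M).
Proof. by rewrite /qform mulmxA -mulmxA -trmx_mul dotvE mxE eqxx mulr1n. Qed.

Lemma dotv_row_mx n (a : R) (v : 'rV[R]_n) :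
  dotv (row_mx a%:M v : 'rV[R]_(1 + n)) (row_mx a%:M v) = a ^+ 2 + dotv v v.
Proof.
rewrite /dotv big_split_ord big_ord1 /= row_mxEl mxE eqxx mulr1n expr2; congr (_ + _).
by apply: eq_bigr => i _; rewrite row_mxEr.
Qed.

Lemma qformZ d (A : 'M[R]_d) (a : R) x : qform A (a *: x) = a ^+ 2 * qform A x.
Proof.
rewrite /qform linearZ/= -scalemxAl -scalemxAl -scalemxAr !mxE.
by rewrite mulrA expr2.
Qed.

Lemma dotvZ d (a : R) (x : 'rV[R]_d) : dotv (a *: x) (a *: x) = a ^+ 2 * dotv x x.
Proof. by rewrite -!qform1 qformZ. Qed.

Lemma normalize_sphere d (x : 'rV[R]_d) : x != 0 -> sphere d ((norm2 x)^-1 *: x).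
Proof.
move=> x0; rewrite /sphere/= {1}/norm2 dotvZ.
have d0 := dotv_gt0 x0.
have -> : (norm2 x)^-1 ^+ 2 = (dotv x x)^-1 by rewrite exprVn sqr_sqrtr// ltW.
by rewrite mulVf ?sqrtr1// gt_eqF.
Qed.

Lemma sphere_dotv d (theta : 'rV[R]_d) : sphere d theta -> dotv theta theta = 1.
Proof. by move=> h; rewrite -[LHS]sqr_sqrtr ?dotv_ge0// [Num.sqrt _]h expr1n. Qed.

(* The last clause comes from back substitution in the triangular factor [M], whose
   diagonal is [m]: [theta *m M = m i *: delta_mx 0 i] has a solution with
   [theta 0 i = 1]. *)
Lemma cholesky n (A : 'M[R]_n) : A^T = A -> (forall x, x != 0 -> 0 < qform A x) ->
  exists (M : 'M[R]_n) (m : 'I_n -> R),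
    [/\ A = M *m M^T, forall i, 0 < m i, \det M = \prod_i m i &
        forall i, exists2 theta, theta != 0 &
          dotv (theta *m M) (theta *m M) <= m i ^+ 2 * dotv theta theta].
Proof.
elim: n A => [|n IH] A AT A_pd.
  exists 0, (fun=> 1); split; [|by case| |by case].
  - by apply/matrixP => -[].
  - by rewrite det_mx00 big_ord0.
have [a [w [D AE]]] : exists (a : R) (w : 'rV[R]_n) (D : 'M[R]_n),
    A = block_mx a%:M w w^T D :> 'M[R]_(1 + n).
  exists (A 0 0), (ursubmx (A : 'M[R]_(1 + n))), (drsubmx (A : 'M[R]_(1 + n))).
  rewrite -[LHS](@submxK _ 1 n 1 n); congr block_mx.
  - by apply/matrixP => i j; rewrite !ord1 !mxE eqxx mulr1n; congr (A _ _); exact: val_inj.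
  - by rewrite (@trmx_ursub _ 1 n 1 n) AT.
have DT : D^T = D.
  have := AT; rewrite AE (@tr_block_mx _ 1 n 1 n) => /(@eq_block_mx _ 1 n 1 n) [_ _ _ ->] //.
have a0 : 0 < a.
  have := A_pd (row_mx 1%:M 0 : 'rV[R]_(1 + n)).
  rewrite /qform AE (@mul_row_block _ 1 1 n 1 n) !mul1mx !mul0mx !addr0 (@tr_row_mx _ 1 1 n).
  rewrite (@mul_row_col _ 1 1 n 1) trmx0 mulmx0 addr0 trmx1 mulmx1 mxE eqxx mulr1n; apply.
  by rewrite (@row_mx_eq0 _ 1 1 n) negb_and matrix_nonzero1.
(* The Schur complement of the corner [a]: its form at [v] is the form of [A] at the vector
   extending [v] by [- (b / a)], the first coordinate that minimizes it. This gives positivity of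
   [S]. *)
pose S := D - a^-1 *: (w^T *m w).
have ST : S^T = S.
  by rewrite /S linearB/= linearZ/= trmx_mul trmxK DT.
have S_pd v : v != 0 -> 0 < qform S v.
  move=> v0; have [b bE] : exists b, b = (v *m w^T) 0 0 by exists ((v *m w^T) 0 0).
  have vw : v *m w^T = b%:M by apply/matrixP => i j; rewrite !ord1 -bE [RHS]mxE eqxx mulr1n.
  have wv : w *m v^T = b%:M by rewrite -[LHS]trmxK trmx_mul trmxK vw tr_scalar_mx.
  have := A_pd (row_mx (- (b / a))%:M v : 'rV[R]_(1 + n)).
  have -> : qform A (row_mx (- (b / a))%:M v : 'rV[R]_(1 + n)) = qform S v.
    rewrite /qform AE (@mul_row_block _ 1 1 n 1 n) (@tr_row_mx _ 1 1 n).
    rewrite (@mul_row_col _ 1 1 n 1) vw -scalar_mxM -raddfD/=.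
    have -> : - (b / a) * a + b = 0 by field; exact: lt0r_neq0.
    rewrite raddf0 mul0mx add0r mulmxDl mul_scalar_mx -scalemxAl wv.
    rewrite /S mulmxBr -scalemxAr mulmxA vw mulmxBl -scalemxAl mul_scalar_mx -scalemxAl wv.
    by rewrite !mxE eqxx mulr1n; field; exact: lt0r_neq0.
  by apply; rewrite (@row_mx_eq0 _ 1 1 n) negb_and v0 orbT.
have [M [m [SE m0 detM hM]]] := IH S ST S_pd.
have sa0 : 0 < Num.sqrt a by rewrite sqrtr_gt0.
have sa2 : Num.sqrt a * Num.sqrt a = a by rewrite -expr2 sqr_sqrtr// ltW.
pose M1 : 'M[R]_(1 + n) := block_mx (Num.sqrt a)%:M 0 ((Num.sqrt a)^-1 *: w^T) M.
exists M1, (fun i => if unlift ord0 i is Some j then m j else Num.sqrt a); split.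
- rewrite AE /M1 (@tr_block_mx _ 1 n 1 n) (@mulmx_block _ 1 n 1 n 1 n).
  rewrite tr_scalar_mx trmx0 !mul0mx !mulmx0 !addr0 -scalar_mxM sa2 linearZ/= trmxK.
  rewrite mul_scalar_mx mul_mx_scalar -scalemxAl -scalemxAr !scalerA -invfM sa2.
  by rewrite !mulfV ?scale1r ?gt_eqF// -SE /S addrC subrK.
- by move=> i; case: unliftP.
- rewrite /M1 (@det_lblock _ 1 n) det_scalar1 detM big_ord_recl unlift_none; congr (_ * _).
  by apply: eq_bigr => i _; rewrite liftK.
- move=> i; case: unliftP => [j _|_].
    have [v v0 hv] := hM j.
    pose b := (v *m w^T) 0 0.
    have vw : v *m w^T = b%:M by apply/matrixP => k l; rewrite !ord1 [RHS]mxE eqxx mulr1n.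
    (* This first coordinate makes the first entry of the product with [M1] vanish, so the left-hand
       side is the one for [v], while the norm on the right can only grow. *)
    exists (row_mx (- (b / a))%:M v : 'rV[R]_(1 + n)).
      by rewrite (@row_mx_eq0 _ 1 1 n) negb_and v0 orbT.
    rewrite /M1 (@mul_row_block _ 1 1 n 1 n) mulmx0 add0r -scalemxAr vw -scalar_mxM.
    rewrite scale_scalar_mx -raddfD/=.
    have -> : - (b / a) * Num.sqrt a + (Num.sqrt a)^-1 * b = 0.
      by rewrite -{1}sa2; field; exact: lt0r_neq0.
    rewrite !dotv_row_mx expr0n/= add0r (le_trans hv)// ler_wpM2l ?sqr_ge0// lerDr sqr_ge0 //.
  exists (row_mx 1%:M 0 : 'rV[R]_(1 + n)).
    by rewrite (@row_mx_eq0 _ 1 1 n) negb_and matrix_nonzero1.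
  rewrite /M1 (@mul_row_block _ 1 1 n 1 n) mul1mx !mul0mx mulmx0 !addr0 !dotv_row_mx.
  by rewrite /dotv big1 ?addr0 ?expr1n ?mulr1// => k _; rewrite mxE mul0r.
Qed.

End quadratic_forms.

(** * Marginals of convex bodies of unit volume *)

Section uniform_unit_volume.
Context {R : realType} {d : nat}.
Variable K : convex_body R d.
Hypothesis K1 : volume K = 1%E.
Local Notation P := (uniform K).

Let mK := measurable_convex_body K.

Lemma uniformE A : P A = volume (A `&` K).
Proof.
rewrite /uniform /= /mnormalize /= /mrestr setTI [volume _]K1.
by rewrite onee_eq0 /= invr1 mule1.
Qed.

Lemma ge0_integral_uniform (g : 'rV[R]_d -> \bar R) : measurable_fun setT g -> (forall x, 0 <=
  g x)%E ->
  (\int[P]_x g x = \int[volume]_(x in K) g x)%E.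
Proof.
move=> mg g0.
rewrite (@ge0_negligible_integral _ _ _ P setT (~` K))//.
- rewrite setTD setCK; apply: eq_measure_integral => A mA AK.
  by rewrite [LHS]uniformE setIidl.
- exact: measurableC.
- by rewrite [LHS]uniformE setICl measure0.
Qed.

Lemma continuous_measurable_EFin (g : 'rV[R]_d -> R) : continuous g ->
  measurable_fun setT (EFin \o g).
Proof. by move=> cg; apply/measurable_EFinP; exact: continuous_measurable_rVR. Qed.

(** The law lives on the compact set [K], where a continuous function is bounded. All means below
    are thus real numbers, and signed integrands cause no trouble. *)
Lemma uniform_integrable (g : 'rV[R]_d -> R) : continuous g -> P.-integrable setT (EFin \o g).
Proof.
move=> cg; apply/(@negligible_integrable _ _ _ P setT (~` K)) => //.
- exact: measurableC.
- exact: continuous_measurable_EFin.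
- by rewrite [LHS]uniformE setICl measure0.
rewrite setTD setCK; apply: measurable_bounded_integrable => //.
- by apply: le_lt_trans (probability_le1 P mK) _; rewrite ltry.
- by apply: measurable_funTS; exact: continuous_measurable_rVR.
- have cgK : compact (g @` K).
    apply: continuous_compact; last exact: convex_body_compact.
    exact: continuous_subspaceT.
  have [M [Mr h]] := compact_bounded cgK.
  by exists M; split => // x Mx y Ky; apply: (h x Mx); exists y.
Qed.

Definition uniform_mean (g : 'rV[R]_d -> R) : R := fine (\int[P]_x (g x)%:E).

Lemma uniform_meanE (g : 'rV[R]_d -> R) : continuous g -> (\int[P]_x (g x)%:E = (uniform_mean
  g)%:E)%E.
Proof. by move=> cg; rewrite fineK//; apply: integrable_fin_num => //; exact:
  uniform_integrable. Qed.

Lemma uniform_meanD (g h : 'rV[R]_d -> R) : continuous g -> continuous h ->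
  uniform_mean (fun x => g x + h x) = uniform_mean g + uniform_mean h.
Proof.
by move=> cg ch; apply: RintegralD => //; exact: uniform_integrable.
Qed.

Lemma uniform_meanZ (a : R) (g : 'rV[R]_d -> R) : continuous g ->
  uniform_mean (fun x => a * g x) = a * uniform_mean g.
Proof.
by move=> cg; apply: RintegralZl => //; exact: uniform_integrable.
Qed.

Lemma uniform_mean_cst a : uniform_mean (fun=> a) = a.
Proof. by rewrite /uniform_mean integral_cst//= probability_setT mule1. Qed.

Lemma uniform_mean_sum n (c : 'I_n -> R) (g : 'I_n -> 'rV[R]_d -> R) : (forall i, continuous (g
  i)) ->
  uniform_mean (fun x => \sum_i c i * g i x) = \sum_i c i * uniform_mean (g i).
Proof.
move=> cg; elim: n c g cg => [|n IH] c g cg.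
  rewrite big_ord0 -[RHS](uniform_mean_cst 0); congr uniform_mean; apply/funext => x.
  by rewrite big_ord0.
rewrite big_ord_recl -IH; last by move=> i; exact: cg.
rewrite -uniform_meanZ// -uniform_meanD.
- by congr uniform_mean; apply/funext => x; rewrite big_ord_recl.
- by move=> x; apply: continuousM; [exact: cst_continuous|exact: cg].
- apply: continuous_big => [|i _ x]; first exact: add_continuous.
  by apply: continuousM; [exact: cst_continuous|exact: cg].
Qed.

Lemma continuous_coord i : continuous (coord i : 'rV[R]_d -> R).
Proof. exact: coord_continuous. Qed.

Lemma continuous_dotv (theta : 'rV[R]_d) : continuous (fun x => dotv x theta).
Proof.
apply: continuous_big => [|i _ x]; first exact: add_continuous.
by apply: continuousM; [exact: coord_continuous|exact: cst_continuous].
Qed.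

Lemma uniform_mean_dotv theta :
  uniform_mean (fun x => dotv x theta) = \sum_i theta 0 i * uniform_mean (coord i).
Proof.
rewrite -uniform_mean_sum; last exact: continuous_coord.
by congr uniform_mean; apply/funext => x; apply: eq_bigr => i _; rewrite mulrC.
Qed.

Definition barycenter : 'rV[R]_d := \row_i uniform_mean (coord i).

Definition covariance_mx : 'M[R]_d :=
  \matrix_(i, j) uniform_mean (fun x => (coord i x - barycenter 0 i) * (coord j x - barycenter
    0 j)).

Lemma expectation_coord i : ('E_P[coord i] = (uniform_mean (coord i))%:E)%E.
Proof. by rewrite unlock uniform_meanE//; exact: continuous_coord. Qed.

Lemma continuous_centered i j :
  continuous (fun x : 'rV[R]_d => (coord i x - barycenter 0 i) * (coord j x - barycenter 0 j)).
Proof.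
have cc k : continuous (fun x : 'rV[R]_d => coord k x - barycenter 0 k).
  move=> x; apply: (@continuousB _ _ _ (coord k) (cst (barycenter 0 k))).
    exact: continuous_coord.
  exact: cst_continuous.
move=> x; exact: (continuousM (cc i x) (cc j x)).
Qed.

Lemma covariance_coord i j : covariance P (coord i) (coord j) = (covariance_mx i j)%:E.
Proof.
rewrite covariance.unlock !expectation_coord expectation.unlock [covariance_mx _ _]mxE.
rewrite -(uniform_meanE (@continuous_centered i j)).
apply: eq_integral => x _; congr _%:E.
by rewrite /= !mxE.
Qed.

Lemma isotropicP : isotropic K <-> barycenter = 0 /\
  exists2 L : R, 0 < L & covariance_mx = (L ^+ 2)%:M.
Proof.
split=> [[m0 [L L0 cov]]|[m0 [L L0 cov]]]; split.
- by apply/rowP => i; have := m0 i; rewrite expectation_coord !mxE => -[].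
- exists L => //; apply/matrixP => i j; have := cov i j.
  by rewrite covariance_coord => -[].
- by move=> i; rewrite expectation_coord; have /rowP /(_ i) := m0; rewrite !mxE => ->.
- by exists L => // i j; rewrite covariance_coord cov.
Qed.

Lemma covariance_dotv (u v : 'rV[R]_d) :
  uniform_mean (fun x => (dotv x u - dotv barycenter u) * (dotv x v - dotv barycenter v)) =
  (u *m covariance_mx *m v^T) 0 0.
Proof.
have centered x w : dotv x w - dotv barycenter w = \sum_i w 0 i * (coord i x - barycenter 0 i).
  by rewrite /dotv -sumrB; apply: eq_bigr => i _; rewrite -mulrBl mulrC.
rewrite mxE.
transitivity (uniform_mean (fun x => \sum_i v 0 i * (\sum_j u 0 j *
    ((coord j x - barycenter 0 j) * (coord i x - barycenter 0 i))))).
  congr uniform_mean; apply/funext => x; rewrite !centered.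
  rewrite mulr_sumr; apply: eq_bigr => i _; rewrite mulrCA; congr (_ * _).
  by rewrite mulr_suml; apply: eq_bigr => j _; rewrite mulrA.
rewrite uniform_mean_sum => [|i]; last first.
  apply: continuous_big => [|j _ x]; first exact: add_continuous.
  exact: (continuousM (@cst_continuous _ _ (u 0 j) x) (@continuous_centered j i x)).
apply: eq_bigr => i _; rewrite uniform_mean_sum => [|j]; last exact: continuous_centered.
rewrite [RHS]mulrC [v^T _ _]mxE [(_ *m _) _ _]mxE; congr (_ * _).
by apply: eq_bigr => j _; rewrite [covariance_mx _ _]mxE.
Qed.

Lemma variance_dotv theta :
  uniform_mean (fun x => (dotv x theta - dotv barycenter theta) ^+ 2) = qform covariance_mx
    theta.
Proof. by rewrite /qform -covariance_dotv; congr uniform_mean; apply/funext => x; rewrite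
  expr2. Qed.

End uniform_unit_volume.

Lemma convex_setE (R : realType) d (A : set 'rV[R]_d) :
  convex_set (A : set (convex_lmodType 'rV[R]_d)) <->
  forall l x y, 0 <= l -> l <= 1 -> A x -> A y -> A ((1 - l) *: x + l *: y).
Proof.
split=> [cA l x y l0 l1 Ax Ay|cA x y l].
  have := cA y x (Itv01 l0 l1); rewrite !inE => /(_ Ay Ax).
  by rewrite -[conv _ _ _]/(l *: y + (1 - l) *: x) addrC.
rewrite !inE => Ax Ay.
rewrite -[conv _ _ _]/(l%:num *: x + (1 - l%:num) *: y).
by rewrite addrC; apply: cA.
Qed.

(** * The density of a marginal *)

Section section_density.
Context {R : realType} {n : nat}.
Variable K : convex_body R n.+1.
Hypothesis K1 : volume K = 1%E.
Variable theta : 'rV[R]_n.+1.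
Hypothesis theta1 : sphere n.+1 theta.
Local Notation P := (uniform K).
Local Notation mu := (@lebesgue_measure R).

Let mK := measurable_convex_body K.

Definition section_density (t : measurableTypeR R) : R :=
  fine (hyperplane_volume theta t (hyperplane theta t `&` K)).

Let U : 'M[R]_(n, n.+1) := xget 0 [set U : 'M[R]_(n.+1.-1, n.+1) | orthonormal_frame theta U].

Let U_frame : orthonormal_frame theta (U : 'M[R]_(n.+1.-1, n.+1)).
Proof. exact: (xgetPex (0 : 'M[R]_(n.+1.-1, n.+1)) (orthonormal_frame_ex theta1)). Qed.

(** An orthogonal matrix with first row [theta], built on the frame chosen in [hyperplane_volume].
    In its coordinates the height along [theta] is the first coordinate, and hyperplane sections of
    [K] are slices of [KH]. *)
Let H : 'M[R]_n.+1 := col_mx theta U.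

Let theta_theta : theta *m theta^T = 1%:M.
Proof. by rewrite dotvE sphere_dotv. Qed.

Let U_theta : U *m theta^T = 0.
Proof.
have [_ h] := U_frame; apply/matrixP => i j; rewrite ord1 [RHS]mxE -[RHS](h i) mxE.
by apply: eq_bigr => k _; rewrite !mxE.
Qed.

Let HHT : H *m H^T = 1%:M.
Proof.
have [UU _] := U_frame.
rewrite /H (@tr_col_mx _ 1 n n.+1) (@mul_col_row _ 1 n n.+1 1 n) theta_theta U_theta UU.
have -> : theta *m U^T = 0 by rewrite -[LHS]trmxK trmx_mul trmxK U_theta trmx0.
by rewrite -(@scalar_mx_block _ 1 n).
Qed.

Let HTH : H^T *m H = 1%:M. Proof. exact: mulmx1C. Qed.

Let detH : `|\det H| = 1.
Proof.
have := congr1 determinant HHT; rewrite det_mulmx det_tr det1 => h.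
by apply/eqP; rewrite -sqrp_eq1// -normrX expr2 h normr1.
Qed.

Let H_unit : H \in unitmx.
Proof. by rewrite unitmxE unitfE -normr_eq0 detH oner_eq0. Qed.

Let cons_mulH t v : cons_rV (t, v) *m H = t *: theta + v *m U.
Proof. by rewrite /cons_rV /H /= -[n.+1]/(1 + n)%N mul_row_col mul_scalar_mx. Qed.

Let dotv_consH t v : dotv (cons_rV (t, v) *m H) theta = t.
Proof.
have : (cons_rV (t, v) *m H) *m theta^T = t%:M.
  by rewrite cons_mulH mulmxDl -scalemxAl theta_theta -mulmxA U_theta mulmx0 addr0 scalemx1.
by rewrite dotvE => /matrixP /(_ 0 0); rewrite !mxE eqxx !mulr1n.
Qed.

Let KH : set 'rV[R]_n.+1 := (fun x => x *m H) @^-1` K.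

Let mKH : measurable KH. Proof. exact: measurable_preimage_mulmx. Qed.

Let KH_bounded : exists2 N : R, 0 < N & KH `<=` @cube R n.+1 N.
Proof.
have KHE : KH = (fun x => x *m H^T) @` K.
  apply/seteqP; split => [x Kx|_ [x Kx <-]].
    by exists (x *m H) => //; rewrite -mulmxA HHT mulmx1.
  by rewrite /KH /= -mulmxA HTH mulmx1.
have : compact KH.
  rewrite KHE; apply: continuous_compact; last exact: convex_body_compact.
  by apply: continuous_subspaceT; exact: continuous_mulmxr.
move=> /compact_bounded [M [_ h]].
exists (`|M| + 1); first by rewrite ltr_wpDl.
move=> x Kx i; rewrite /= in_itv/= -ler_norml.
have : `|x| <= `|M| + 1 by apply: (h (`|M| + 1)) => //; rewrite ltr_pwDr// ler_norm.
apply: le_trans.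
rewrite /Num.norm/= mx_normrE.
exact: (le_bigmax _ (fun ij : 'I_1 * 'I_n.+1 => `|x ij.1 ij.2|) (0, i)).
Qed.

Lemma hyperplane_volumeE t : hyperplane_volume theta t (hyperplane theta t `&` K) =
  volume [set v | KH (cons_rV (t, v))].
Proof.
rewrite /hyperplane_volume; congr volume; apply/seteqP; split => v /=.
  by rewrite /KH /= cons_mulH => -[].
by rewrite /KH /= => Kv; split; rewrite -/U -cons_mulH// /hyperplane/= dotv_consH.
Qed.

Let section_fin t : volume [set v | KH (cons_rV (t, v))] \is a fin_num.
Proof.
have [N N0 KN] := KH_bounded.
apply: (@volume_sub_cube_fin _ _ N); last exact: cube_slice.
exact: measurable_volume_slice.
Qed.

Lemma section_densityE t :
  hyperplane_volume theta t (hyperplane theta t `&` K) = (section_density t)%:E.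
Proof. by rewrite /section_density fineK// hyperplane_volumeE. Qed.

Lemma section_density_ge0 t : 0 <= section_density t.
Proof. by rewrite /section_density fine_ge0. Qed.

Lemma measurable_section_density : measurable_fun setT section_density.
Proof.
apply: measurableT_comp => //.
rewrite (_ : (fun t => _) = fun t => volume [set v | KH (cons_rV (t, v))]).
  exact: measurable_volume_section.
by apply/funext => t; rewrite hyperplane_volumeE.
Qed.

(** Rotate by [H], which preserves volume, and apply Fubini with the first coordinate outermost: on
    the slice at height [t] the integrand is the constant [phi t]. *)
Lemma integral_section_density (phi : measurableTypeR R -> R) : measurable_fun setT phi ->
  (forall t, 0 <= phi t) ->
  (\int[P]_x (phi (dotv x theta))%:E = \int[mu]_t (phi t * section_density t)%:E)%E.
Proof.
move=> mphi phi0.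
have mdot : measurable_fun setT (fun x : 'rV[R]_n.+1 => phi (dotv x theta)).
  by apply: (measurableT_comp mphi); apply: continuous_measurable_rVR; exact: continuous_dotv.
have mdotE : measurable_fun setT (fun x : 'rV[R]_n.+1 => (phi (dotv x theta))%:E).
  exact/measurable_EFinP.
rewrite (ge0_integral_uniform K1)//; last by move=> x; rewrite lee_fin.
have mH : measurable_fun setT (fun x : 'rV[R]_n.+1 => x *m H).
  by apply: continuous_measurable_rV; exact: continuous_mulmxr.
transitivity (\int[pushforward volume (fun x : 'rV[R]_n.+1 => x *m H)]_(x in K) (phi (dotv x
  theta))%:E)%E.
  apply: (@eq_measure_integral _ _ _ _
    (measure_function_pushforward__canonical__measure_function_Measure volume mH)).
  move=> A mA _; rewrite -[LHS](scales_volume_unitmx H_unit mA) detH mule1 //.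
rewrite (@ge0_integral_pushforward _ _ _ _ R _ mH volume K)//; last 2 first.
- exact: measurable_funTS.
- by move=> x _; rewrite lee_fin.
rewrite -/KH.
transitivity (\int[pushforward (mu \x volume)%E (@cons_rV R n)]_(x in KH) (phi (dotv (x *m H)
  theta))%:E)%E.
  by [].
rewrite (@ge0_integral_pushforward _ _ _ _ R _ (@measurable_cons_rV R n) (mu \x volume)%E
  KH)//; last 2 first.
- apply: measurable_funTS; exact: (measurableT_comp mdotE mH).
- by move=> x _; rewrite lee_fin.
rewrite integral_mkcond fubini_tonelli1; last 2 first.
- apply/(measurable_restrictT _ _).1; first exact: measurable_preimage_cons_rV.
  apply: measurable_funTS; apply: (measurableT_comp (measurableT_comp mdotE mH)).
  exact: measurable_cons_rV.
- by move=> x; rewrite patchE; case: ifP => // _; rewrite lee_fin.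
apply: eq_integral => t _; rewrite /fubini_F.
transitivity (\int[volume]_(v in [set v | KH (cons_rV (t, v))]) (phi t)%:E)%E.
  rewrite [RHS]integral_mkcond; apply: eq_integral => v _; rewrite !patchE.
  rewrite (_ : ((t, v) \in _) = (v \in [set v | KH (cons_rV (t, v))])).
    by case: ifP => // _ /=; rewrite dotv_consH.
  by apply/idP/idP; rewrite !inE.
rewrite integral_cst; last exact: measurable_volume_slice.
by rewrite EFinM -section_densityE hyperplane_volumeE.
Qed.

Lemma section_density_log_concave : exists2 M : R, 0 < M & log_concave_density M
  section_density.
Proof.
have [N N0 KN] := KH_bounded.
(* The slices at heights [N] and [-N] may be nonempty, so the density is only known to vanish from
   some larger bound on. *)
exists (N + 1); first by rewrite ltr_wpDl// ltW.
split.
- exact: measurable_section_density.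
- exists (fine (volume (@cube R n N))) => t.
  rewrite section_density_ge0/= /section_density hyperplane_volumeE fine_le ?volume_cube_fin//.
  apply: le_measure; rewrite ?inE; [exact: measurable_volume_slice|exact: measurable_cube|].
  exact: cube_slice.
- move=> t Nt; rewrite /section_density hyperplane_volumeE.
  rewrite (_ : [set v | _] = set0) ?measure0// -subset0 => v /= /KN /(_ ord0).
  rewrite /= cons_rV0 in_itv/= -ler_norml => h.
  by have := le_trans Nt h; rewrite gerDl ler10.
- move=> l x y l0 l1; rewrite /section_density !hyperplane_volumeE.
  apply: (brunn_minkowski l0 l1 (M := N)); try exact: measurable_volume_slice; try exact:
    cube_slice.
  move=> v w Kv Kw; rewrite /= -cons_rV_comb /KH /= mulmxDl -!scalemxAl.
  have /convex_setE := @convex_body_convex _ _ K.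
  by apply; rewrite // ltW.
- rewrite -[RHS](probability_setT P) -[RHS]mul1e -integral_cst//.
  rewrite (integral_section_density (phi := fun=> 1))//.
  by apply: eq_integral => t _; rewrite mul1r.
Qed.

End section_density.

(** * Variance of a marginal and size of the sections *)

Section marginals.
Context {R : realType} {n : nat}.
Variable K : convex_body R n.+1.
Hypothesis K1 : volume K = 1%E.
Local Notation P := (uniform K).
Local Notation mu := (@lebesgue_measure R).

Section direction.
Variable theta : 'rV[R]_n.+1.
Hypothesis theta1 : sphere n.+1 theta.
Local Notation f := (section_density K theta).

Let f0 := section_density_ge0 K theta.
Let mf := measurable_section_density K theta1.

Let msq c : measurable_fun setT (fun t : measurableTypeR R => (t - c) ^+ 2).
Proof. by apply: measurable_funX; exact: measurable_funB. Qed.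

Lemma continuous_sq_dotv (c : R) : continuous (fun x : 'rV[R]_n.+1 => (dotv x theta - c) ^+ 2).
Proof.
have h : continuous (fun x : 'rV[R]_n.+1 => dotv x theta - c).
  move=> x; apply: (@continuousB _ _ _ (fun x : 'rV[R]_n.+1 => dotv x theta) (cst c)).
    exact: continuous_dotv.
  exact: cst_continuous.
by move=> x; exact: (continuousM (h x) (h x)).
Qed.

Lemma second_moment_section_density c :
  (\int[mu]_t ((t - c) ^+ 2 * f t)%:E =
   (uniform_mean K (fun x => (dotv x theta - c) ^+ 2))%:E)%E.
Proof.
rewrite -(uniform_meanE K1 (@continuous_sq_dotv c)).
by rewrite -(integral_section_density K1 theta1 (msq c))// => t; rewrite sqr_ge0.
Qed.

Lemma mass_section_density : (\int[mu]_t (f t)%:E = 1)%E.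
Proof. by have [M _ lf] := section_density_log_concave K1 theta1; exact: lcd_mass lf. Qed.

(** If all sections were smaller than [1 / (8 L)], the window of half-width [2 L] around the mean
    would carry at most 1/2 of the mass, and by Chebyshev its complement at most 1/4. *)
Lemma section_ge_of_variance_le (L : R) : 0 < L -> qform (covariance_mx K) theta <= L ^+ 2 ->
  exists t, ((8 * L)^-1%:E <= hyperplane_volume theta t (hyperplane theta t `&` K))%E.
Proof.
move=> L0 VL; pose c := dotv (barycenter K) theta.
apply: contrapT => /forallNP h.
have fl t : f t <= (8 * L)^-1.
  by rewrite leNgt; apply/negP => ft; apply: (h t); rewrite section_densityE// lee_fin ltW.
pose g (t : measurableTypeR R) : R := if (c - 2 * L <= t) && (t <= c + 2 * L) then (8 * L)^-1
  else 0.
have L8 : 0 <= (8 * L)^-1 by rewrite invr_ge0; lra.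
have mg : measurable_fun setT g.
  apply: measurable_fun_if => //; apply: measurable_and; exact: measurable_fun_ler.
have g0 t : 0 <= g t by rewrite /g; case: ifP.
have gi : (\int[mu]_t (g t)%:E = (2^-1)%:E)%E.
  transitivity (\int[mu]_(t in `[(c - 2 * L)%R, (c + 2 * L)%R]) ((8 * L)^-1)%:E)%E.
    rewrite [RHS]integral_mkcond; apply: eq_integral => t _.
    by rewrite patchE mem_setE in_itv/= /g; case: ifP.
  rewrite integral_cst//= lebesgue_measure_itv/= lte_fin ifT; last by lra.
  by rewrite -EFinB -EFinM; congr _%:E; field; rewrite gt_eqF.
have k0 : 0 <= (4 * L ^+ 2)^-1 by rewrite invr_ge0 mulr_ge0// sqr_ge0.
have L2 : 0 < L ^+ 2 by rewrite exprn_gt0.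
have mq : measurable_fun setT (fun t : measurableTypeR R => (t - c) ^+ 2 * f t).
  exact: measurable_funM.
have mkq : measurable_fun setT (fun t : measurableTypeR R => (4 * L ^+ 2)^-1 * ((t - c) ^+ 2 *
  f t)).
  exact: measurable_funM.
have q0 t : 0 <= (t - c) ^+ 2 * f t by rewrite mulr_ge0// sqr_ge0.
have kq0 t : 0 <= (4 * L ^+ 2)^-1 * ((t - c) ^+ 2 * f t) by rewrite mulr_ge0.
have := ge0_le_integral_real mu mf (measurable_funD mg mkq) f0.
have pt t : f t <= g t + (4 * L ^+ 2)^-1 * ((t - c) ^+ 2 * f t).
  rewrite /g; case: ifPn => [_|tc]; first by rewrite (le_trans (fl t))// lerDl.
  rewrite add0r mulrA -[leLHS]mul1r ler_wpM2r//.
  rewrite mulrC ler_pdivlMr ?mulr_gt0// mul1r.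
  move: tc; rewrite negb_and -!ltNge => /orP[]h1; nra.
move=> /(_ pt); rewrite (ge0_integralD_real mu mg g0 mkq kq0) gi.
rewrite (ge0_integralZ_real mu mq q0 k0) second_moment_section_density (variance_dotv K1)
  mass_section_density.
rewrite -EFinM -EFinD lee_fin => h1.
have : (4 * L ^+ 2)^-1 * qform (covariance_mx K) theta <= (4 * L ^+ 2)^-1 * L ^+ 2.
  by rewrite ler_wpM2l.
have -> : (4 * L ^+ 2)^-1 * L ^+ 2 = 4^-1 by field; rewrite gt_eqF.
lra.
Qed.

(** A density bounded by [B] puts at most half of its mass within [e = 1 / (4 (B + 1))] of the mean,
    so the variance is at least [e^2 / 2]. This makes the covariance matrix positive definite. *)
Lemma variance_gt0 : 0 < qform (covariance_mx K) theta.
Proof.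
pose c := dotv (barycenter K) theta.
have [M M0 lf] := section_density_log_concave K1 theta1.
have [B fB] := lcd_bounded lf.
have B0 : 0 <= B by case/andP: (fB 0) => h1 h2; exact: le_trans h2.
pose e := (4 * (B + 1))^-1.
have e0 : 0 < e by rewrite invr_gt0; lra.
pose g (t : measurableTypeR R) : R := if (c - e <= t) && (t <= c + e) then e ^+ 2 * B else 0.
have e2 : 0 <= e ^+ 2 by rewrite sqr_ge0.
have mg : measurable_fun setT g.
  apply: measurable_fun_if => //; apply: measurable_and; exact: measurable_fun_ler.
have g0 t : 0 <= g t by rewrite /g; case: ifP => // _; rewrite mulr_ge0.
have gi : (\int[mu]_t (g t)%:E = (e ^+ 2 * (B * (2 * e)))%:E)%E.
  transitivity (\int[mu]_(t in `[(c - e)%R, (c + e)%R]) (e ^+ 2 * B)%:E)%E.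
    rewrite [RHS]integral_mkcond; apply: eq_integral => t _.
    by rewrite patchE mem_setE in_itv/= /g; case: ifP.
  rewrite integral_cst//= lebesgue_measure_itv/= lte_fin ifT; last by lra.
  by rewrite -EFinB -EFinM; congr _%:E; ring.
have mq : measurable_fun setT (fun t : measurableTypeR R => (t - c) ^+ 2 * f t).
  exact: measurable_funM.
have q0 t : 0 <= (t - c) ^+ 2 * f t by rewrite mulr_ge0// sqr_ge0.
have mef : measurable_fun setT (fun t : measurableTypeR R => e ^+ 2 * f t) by exact:
  measurable_funM.
have ef0 t : 0 <= e ^+ 2 * f t by rewrite mulr_ge0.
have := ge0_le_integral_real mu mef (measurable_funD mg mq) ef0.
have pt t : e ^+ 2 * f t <= g t + (t - c) ^+ 2 * f t.
  rewrite /g; case: ifPn => [_|tc].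
    apply: (@le_trans _ _ (e ^+ 2 * B)); last by rewrite lerDl.
    by rewrite ler_wpM2l//; case/andP: (fB t).
  rewrite add0r ler_wpM2r//.
  move: tc; rewrite negb_and -!ltNge => /orP[]h1; nra.
move=> /(_ pt); rewrite (ge0_integralD_real mu mg g0 mq q0) gi.
rewrite (ge0_integralZ_real mu mf f0 e2) second_moment_section_density (variance_dotv K1)
  mass_section_density.
rewrite -EFinM -EFinD lee_fin mulr1 => h1.
have Be : B * (2 * e) <= 2^-1.
  rewrite /e -(ler_pM2r (_ : 0 < 4 * (B + 1))); last by lra.
  have -> : B * (2 * (4 * (B + 1))^-1) * (4 * (B + 1)) = 2 * B by field; rewrite gt_eqF//; lra.
  lra.
have : e ^+ 2 * (B * (2 * e)) <= e ^+ 2 * 2^-1 by rewrite ler_wpM2l.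
have : 0 < e ^+ 2 by rewrite exprn_gt0.
lra.
Qed.

End direction.

Lemma covariance_mx_tr : (covariance_mx K)^T = covariance_mx K.
Proof.
apply/matrixP => i j; rewrite ![_ _ i j]mxE [covariance_mx _ _ _]mxE; congr uniform_mean.
by apply/funext => x; rewrite mulrC.
Qed.

Lemma covariance_mx_pd x : x != 0 -> 0 < qform (covariance_mx K) x.
Proof.
move=> x0; have := variance_gt0 (normalize_sphere x0); rewrite qformZ.
by rewrite pmulr_rgt0// exprn_gt0// invr_gt0 sqrtr_gt0 dotv_gt0.
Qed.

End marginals.

(** * Isotropic bodies *)

Section isotropic_bodies.
Context {R : realType} {n : nat}.
Variable K : convex_body R n.+1.
Hypothesis K1 : volume K = 1%E.
Local Notation P := (uniform K).
Local Notation mu := (@lebesgue_measure R).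
Variable L : R.
Hypothesis L0 : 0 < L.
Hypothesis bary0 : barycenter K = 0.
Hypothesis covL : covariance_mx K = (L ^+ 2)%:M.

Lemma isotropic_moment theta c : sphere n.+1 theta ->
  uniform_mean K (fun x => (dotv x theta - c) ^+ 2) = L ^+ 2 + c ^+ 2.
Proof.
move=> theta1.
have V : uniform_mean K (fun x => (dotv x theta - 0) ^+ 2) = L ^+ 2.
  have := variance_dotv K1 theta; rewrite bary0.
  have -> : dotv (0 : 'rV[R]_n.+1) theta = 0 by rewrite /dotv big1// => i _; rewrite mxE mul0r.
  by move=> ->; rewrite covL -scalemx1 /qform -scalemxAr -scalemxAl mxE [X in _ * X]qform1
    sphere_dotv// mulr1.
have m0 : uniform_mean K (fun x => dotv x theta) = 0.
  rewrite uniform_mean_dotv// big1// => i _.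
  by have /rowP /(_ i) := bary0; rewrite !mxE => ->; rewrite mulr0.
have cd : continuous (fun x : 'rV[R]_n.+1 => dotv x theta) by exact: continuous_dotv.
have cq := @continuous_sq_dotv R n theta 0.
have ccd : continuous (fun x : 'rV[R]_n.+1 => - 2 * c * dotv x theta).
  by move=> x; exact: (continuousM (@cst_continuous _ _ (- 2 * c) x) (cd x)).
have cc : continuous (fun x : 'rV[R]_n.+1 => c ^+ 2) by move=> x; exact: cst_continuous.
have cs : continuous (fun x : 'rV[R]_n.+1 => - 2 * c * dotv x theta + c ^+ 2).
  by move=> x; exact: (continuousD (ccd x) (cc x)).
transitivity (uniform_mean K (fun x =>
    (dotv x theta - 0) ^+ 2 + (- 2 * c * dotv x theta + c ^+ 2))).
  by congr uniform_mean; apply/funext => x; ring.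
rewrite (uniform_meanD K1 cq cs) V (uniform_meanD K1 ccd cc) (uniform_meanZ K1 _ cd).
by rewrite m0 mulr0 add0r uniform_mean_cst.
Qed.

Section direction.
Variable theta : 'rV[R]_n.+1.
Hypothesis theta1 : sphere n.+1 theta.
Local Notation f := (section_density K theta).

Lemma isotropic_second_moment : (\int[mu]_u (u ^+ 2 * f u)%:E = (L ^+ 2)%:E)%E.
Proof.
have := second_moment_section_density K1 theta1 0.
rewrite (isotropic_moment _ theta1) expr0n/= addr0 => <-.
by apply: eq_integral => u _; rewrite subr0.
Qed.

(** By isotropy the second moments about [M] and [-M] are equal, and [(u + M)^2 + 4 M (M - u) = (u -
    M)^2 + 4 M^2]; comparing integrals gives the value. *)
Lemma isotropic_mean M : 0 < M -> log_concave_density M f ->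
  (\int[mu]_u ((M - u) * f u)%:E = M%:E)%E.
Proof.
move=> M0 lf; have mf := lcd_measurable lf.
have f0 := section_density_ge0 K theta.
have msq c : measurable_fun setT (fun t : measurableTypeR R => (t - c) ^+ 2 * f t).
  by apply: measurable_funM => //; apply: measurable_funX; exact: measurable_funB.
have sq0 c t : 0 <= (t - c) ^+ 2 * f t by rewrite mulr_ge0// sqr_ge0.
have mM : measurable_fun setT (fun u : measurableTypeR R => (M - u) * f u).
  by apply: measurable_funM => //; exact: measurable_funB.
have M0f u : 0 <= (M - u) * f u.
  have [uM|uM] := leP M `|u|; first by rewrite (lcd_support lf uM) mulr0.
  by rewrite mulr_ge0// subr_ge0 (le_trans (ler_norm u))// ltW.
have M4 : 0 <= 4 * M by lra.
have MM4 : 0 <= 4 * M ^+ 2 by rewrite mulr_ge0// sqr_ge0.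
(* polarization with nonnegative terms only *)
have e : (\int[mu]_u ((u - - M) ^+ 2 * f u + 4 * M * ((M - u) * f u))%:E =
    \int[mu]_u ((u - M) ^+ 2 * f u + 4 * M ^+ 2 * f u)%:E)%E.
  by apply: eq_integral => u _; congr _%:E; ring.
have mMZ : measurable_fun setT (fun u : measurableTypeR R => 4 * M * ((M - u) * f u)).
  exact: measurable_funM.
have MZ0 u : 0 <= 4 * M * ((M - u) * f u) by rewrite mulr_ge0.
have mfZ : measurable_fun setT (fun u : measurableTypeR R => 4 * M ^+ 2 * f u).
  exact: measurable_funM.
have fZ0 u : 0 <= 4 * M ^+ 2 * f u by rewrite mulr_ge0.
rewrite (ge0_integralD_real mu (msq (- M)) (sq0 (- M)) mMZ MZ0) in e.
rewrite (ge0_integralD_real mu (msq M) (sq0 M) mfZ fZ0) in e.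
rewrite (lcd_integralZ lf MM4) (ge0_integralZ_real mu mM M0f M4) in e.
rewrite !(second_moment_section_density K1 theta1) !(isotropic_moment _ theta1) sqrrN in e.
have X0 : (0 <= \int[mu]_u ((M - u) * f u)%:E)%E by apply: integral_ge0 => u _; rewrite lee_fin.
move: e X0; case: (\int[mu]_u _)%E => [r| |]//; last first.
  by rewrite gt0_muley ?lte_fin//; lra.
rewrite -EFinM -!EFinD => -[h] _; congr _%:E.
have : 4 * M * r = 4 * M * M by lra.
by apply: mulfI; rewrite gt_eqF//; lra.
Qed.

(** The second moment about [t] is at least [L^2] and, by the variance bound, at most
    [256 / f t ^ 2]. *)
Lemma isotropic_constant_le c t : 0 < c ->
  (c%:E <= hyperplane_volume theta t (hyperplane theta t `&` K))%E -> L <= 16 / c.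
Proof.
move=> c0; rewrite section_densityE// lee_fin => ct.
have [M M0 lf] := section_density_log_concave K1 theta1.
have ft0 : 0 < f t by exact: lt_le_trans ct.
have := le_trans (lcd_second_moment_le lf M0 (isotropic_mean M0 lf) t) (lcd_variance lf ft0).
rewrite isotropic_second_moment lee_fin => h.
apply: (@le_trans _ _ (16 / f t)).
  rewrite -ler_sqr ?nnegrE ?divr_ge0 ?(ltW L0) ?(ltW ft0)// expr_div_n.
  by have -> : 16 ^+ 2 = 256 :> R by ring.
by rewrite ler_wpM2l// lef_pV2.
Qed.

Lemma measurable_halfspace t : measurable (halfspace theta t : set 'rV[R]_n.+1).
Proof.
rewrite -[X in measurable X]setTI.
rewrite (_ : halfspace theta t = (fun x => dotv x theta) @^-1` `[t, +oo[%classic).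
  apply: (continuous_measurable_rVR (continuous_dotv (theta := theta))) => //.
by apply/seteqP; split => x /=; rewrite in_itv/= andbT.
Qed.

Lemma halfspace_cdf t : (volume (halfspace theta t `&` K) + (lcd_cdf f t)%:E = 1)%E.
Proof.
have [M M0 lf] := section_density_log_concave K1 theta1.
have mf := lcd_measurable lf; have f0 := section_density_ge0 K theta.
pose phi (u : measurableTypeR R) : R := if t <= u then 1 else 0.
have mphi : measurable_fun setT phi.
  by apply: measurable_fun_if => //; exact: measurable_fun_ler.
have phi0 u : 0 <= phi u by rewrite /phi; case: ifP.
have mpf : measurable_fun setT (fun u : measurableTypeR R => phi u * f u) by exact:
  measurable_funM.
have pf0 u : 0 <= phi u * f u by rewrite mulr_ge0.
rewrite -(lcd_cdfE lf) -(uniformE K1).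
have -> : P (halfspace theta t) = (\int[mu]_u (phi u * f u)%:E)%E.
  rewrite -(integral_section_density K1 theta1 mphi phi0).
  rewrite -[halfspace theta t]setIT -(integral_indic _ measurableT) //; last exact:
    measurable_halfspace.
  apply: eq_integral => x _; congr _%:E; rewrite indicE /phi.
  by case: ifPn => h; [rewrite mem_set|rewrite memNset//=; exact/negP].
rewrite -(ge0_integralD_real mu mpf pf0 (measurable_cut lf t) (cut_ge0 lf t)) -(lcd_mass lf).
apply: eq_integral => u _; congr _%:E; rewrite /phi /cut.
by case: leP => _; rewrite ?mul1r ?mul0r ?addr0 ?add0r.
Qed.

End direction.

(** Take [theta] opposite to [x]. By Chebyshev the half-space [dotv y theta >= - L / sqrt delta]
    contains at least the fraction [1 - delta] of [K], so it is one of those intersected; it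
    contains [x] only if [norm2 x <= L / sqrt delta]. *)
Lemma floating_body_sub_ball delta : 0 < delta ->
  floating_body delta K `<=` ball2 0 (L / Num.sqrt delta).
Proof.
move=> d0 x xK; rewrite /ball2/= subr0.
have sd0 : 0 < Num.sqrt delta by rewrite sqrtr_gt0.
have [->|x0] := eqVneq x 0.
  rewrite /norm2 (_ : dotv 0 0 = 0) ?sqrtr0 ?divr_ge0 ?(ltW L0) ?(ltW sd0)//.
  by rewrite /dotv big1// => i _; rewrite mxE mul0r.
pose theta : 'rV[R]_n.+1 := (norm2 (- x))^-1 *: (- x).
have theta1 : sphere n.+1 theta by apply: normalize_sphere; rewrite oppr_eq0.
have nx0 : 0 < norm2 x by rewrite sqrtr_gt0 dotv_gt0.
have nN : norm2 (- x) = norm2 x.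
  by rewrite /norm2; congr Num.sqrt; apply: eq_bigr => i _; rewrite mxE mulrNN.
have xtheta : dotv x theta = - norm2 x.
  have -> : dotv x theta = - ((norm2 x)^-1 * dotv x x).
    rewrite /theta nN /dotv mulr_sumr -sumrN; apply: eq_bigr => i _.
    by rewrite !mxE; ring.
  rewrite -[dotv x x]sqr_sqrtr ?dotv_ge0// -/(norm2 x) expr2 mulrA mulVf ?mul1r//.
  by rewrite gt_eqF.
pose t := - (L / Num.sqrt delta).
suff : halfspace theta t x by rewrite /halfspace/= xtheta /t lerN2.
apply: (xK (theta, t)); split => //=.
rewrite [X in (_ * X)%E]K1 mule1.
have mH := measurable_halfspace theta t.
have cq := @continuous_sq_dotv R n theta 0.
pose k := delta / L ^+ 2.
have L2 : 0 < L ^+ 2 by rewrite exprn_gt0.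
have k0 : 0 <= k by rewrite divr_ge0// ltW.
have m1 : measurable_fun setT (\1_(halfspace theta t) : 'rV[R]_n.+1 -> R).
  exact: measurable_indic.
have mq : measurable_fun setT (fun x : 'rV[R]_n.+1 => (dotv x theta - 0) ^+ 2).
  exact: continuous_measurable_rVR.
have q0 y : 0 <= (dotv y theta - 0) ^+ 2 by rewrite sqr_ge0.
have mkq : measurable_fun setT (fun x : 'rV[R]_n.+1 => k * (dotv x theta - 0) ^+ 2).
  exact: measurable_funM.
have kq0 y : 0 <= k * (dotv y theta - 0) ^+ 2 by rewrite mulr_ge0.
have i0 y : 0 <= \1_(halfspace theta t) y :> R by rewrite indicE.
have pt y : (1 : R) <= \1_(halfspace theta t) y + k * (dotv y theta - 0) ^+ 2.
  rewrite indicE; have [hy|hy] := boolP (y \in halfspace theta t); first by rewrite lerDl.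
  rewrite add0r subr0 /k mulrAC ler_pdivlMr// mul1r.
  have h : dotv y theta < t by rewrite ltNge; apply/negP => h; move/negP: hy; apply; rewrite
    inE.
  have : L ^+ 2 / delta <= dotv y theta ^+ 2.
    rewrite -[delta in X in X <= _]sqr_sqrtr ?(ltW d0)// -expr_div_n -[leRHS]sqrrN.
    rewrite ler_sqr ?nnegrE ?divr_ge0 ?(ltW L0) ?(ltW sd0)//; last first.
      by rewrite oppr_ge0 ltW// (lt_le_trans h)// /t oppr_le0 divr_ge0 ?ltW.
    by rewrite lerNr ltW.
  by rewrite ler_pdivrMr// mulrC.
have := @ge0_le_integral_real _ _ _ P (fun=> 1) _ (measurable_cst _) (measurable_funD m1 mkq)
  (fun=> ler01) pt.
rewrite (ge0_integralD_real P m1 i0 mkq kq0) (ge0_integralZ_real P mq q0 k0).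
rewrite (uniform_meanE K1 cq) (isotropic_moment _ theta1) expr0n/= addr0.
have e1 : (\int[P]_x (1 : R)%:E = 1)%E by rewrite integral_cst//= probability_setT mule1.
have e2 : (\int[P]_x (\1_(halfspace theta t) x)%:E = volume (halfspace theta t `&` K))%E.
  by rewrite integral_indic// setIT; exact: uniformE.
rewrite e1 e2.
rewrite -EFinM (_ : k * L ^+ 2 = delta); last by rewrite /k; field; rewrite gt_eqF.
by move=> h; rewrite EFinB leeBlDr.
Qed.

(** One point of norm [k] in the floating body is enough. An admissible half-space at height [t]
    leaves out mass at most [delta], hence [t <= - k] by the quantile bound, while [k] times the
    first basis vector has height at least [- k] in every unit direction. *)
Lemma isotropic_constant_le_floating delta r : 0 < delta -> delta < expR (- 1) ->
  floating_body delta K `<=` ball2 0 r -> - (1 + ln delta) * (delta / 64) * L <= r.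
Proof.
move=> d0 d1 Kr; pose k := - (1 + ln delta) * (delta / 64) * L.
have k0 : 0 <= k.
  have : ln delta < ln (expR (- 1)) by rewrite ltr_ln ?posrE ?expR_gt0.
  rewrite expRK => h; rewrite /k mulr_ge0 ?(ltW L0)// mulr_ge0 ?divr_ge0 ?(ltW d0)//; lra.
pose x : 'rV[R]_n.+1 := k *: delta_mx 0 0.
have dx theta : dotv x theta = k * theta 0 0.
  rewrite /dotv (bigD1 0)//= big1 ?addr0 => [|i i0]; first by rewrite !mxE !eqxx mulr1.
  by rewrite !mxE eqxx (negbTE i0) mulr0 mul0r.
have : ball2 0 r x.
  apply: Kr => -[theta t] [/= theta1]; rewrite [X in (_ * X)%E]K1 mule1 => ht.
  rewrite /halfspace/= dx.
  have [M M0 lf] := section_density_log_concave K1 theta1.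
  have Ft : lcd_cdf (section_density K theta) t <= delta.
    rewrite -lee_fin -(@leeD2lE _ (1 - delta)%:E)//.
    have -> : ((1 - delta)%:E + delta%:E = 1)%E by rewrite -EFinD subrK.
    by rewrite -(halfspace_cdf theta1 t) leeD2r.
  have := gruenbaum_quantile lf M0 (isotropic_mean theta1 M0 lf) d0 d1 L0
    (isotropic_second_moment theta1) Ft.
  have th : - 1 <= theta 0 0.
    have : theta 0 0 ^+ 2 <= 1.
      rewrite -(sphere_dotv theta1) /dotv (bigD1 0)//= -expr2 lerDl.
      by apply: sumr_ge0 => i _; rewrite -expr2 sqr_ge0.
    by nra.
  have : - k <= k * theta 0 0 by rewrite -[leLHS]mulrN1 ler_wpM2l.
  rewrite /k; lra.
rewrite /ball2/= subr0 /norm2 dx /x !mxE !eqxx mulr1 -expr2 sqrtr_sqr ger0_norm//.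
Qed.
End isotropic_bodies.

(** * Volume-preserving affine changes of position *)

Section affine_image.
Context {R : realType} {d : nat}.
Variable K : convex_body R d.
Hypothesis K1 : volume K = 1%E.
Variables (T : 'M[R]_d) (b : 'rV[R]_d).
Hypothesis T_unit : T \in unitmx.
Hypothesis detT : `|\det T| = 1.

Let S (y : 'rV[R]_d) := y *m T + b.
Let S' (x : 'rV[R]_d) := (x - b) *m invmx T.

Let SK x : S (S' x) = x.
Proof. by rewrite /S /S' -mulmxA mulVmx// mulmx1 subrK. Qed.

Let S'K y : S' (S y) = y.
Proof. by rewrite /S /S' addrK -mulmxA mulmxV// mulmx1. Qed.

Let continuous_S : continuous S.
Proof.
by move=> y; exact: (continuousD (@continuous_mulmxr R d d T y) (@cst_continuous _ _ b y)).
Qed.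

Let continuous_S' : continuous S'.
Proof.
have h : continuous (fun x : 'rV[R]_d => x - b).
  by move=> x; apply: continuousB => //; exact: cst_continuous.
move=> x; apply: (@continuous_comp _ _ _ (fun x : 'rV[R]_d => x - b) (fun z => z *m invmx T)).
  exact: h.
exact: continuous_mulmxr.
Qed.

Let K' : set 'rV[R]_d := S @^-1` K.

Let K'_compact : compact K'.
Proof.
have -> : K' = S' @` K.
  apply/seteqP; split => [y Ky|_ [x Kx <-]]; last by rewrite /K'/= SK.
  by exists (S y).
apply: continuous_compact; last exact: convex_body_compact.
exact: continuous_subspaceT.
Qed.

Let K'_convex : convex_set (K' : set (convex_lmodType 'rV[R]_d)).
Proof.
apply/convex_setE => l x y l0 l1 Kx Ky.
have /convex_setE /(_ l _ _ l0 l1 Kx Ky) := @convex_body_convex _ _ K.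
rewrite /K'/= (_ : _ + _ = S ((1 - l) *: x + l *: y))//.
rewrite /S !scalerDr mulmxDl -!scalemxAl addrACA -scalerDl subrK scale1r //.
Qed.

Let K'_interior : K'° !=set0.
Proof.
have [x Kx] := convex_body_interior K.
exists (S' x); rewrite /interior/=; apply: continuous_S; rewrite SK; exact: Kx.
Qed.

Definition affine_preimage : convex_body R d := ConvexBody K'_compact K'_convex K'_interior.

Let volume_S A : measurable A -> volume (S @^-1` A) = volume A.
Proof.
move=> mA.
have mA' : measurable ((fun x => x + b) @^-1` A).
  rewrite -[X in measurable X]setTI; apply: continuous_measurable_rV => //.
  by move=> x; apply: continuousD => //; exact: cst_continuous.
rewrite -[RHS](volume_translate b mA) -[RHS](scales_volume_unitmx T_unit mA').
by rewrite detT mule1.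
Qed.

Lemma volume_affine_preimage : volume affine_preimage = 1%E.
Proof. by rewrite -K1; exact: (volume_S (measurable_convex_body K)). Qed.

Lemma uniform_mean_affine_preimage (g : 'rV[R]_d -> R) : continuous g ->
  uniform_mean affine_preimage (fun y => g (y *m T + b)) = uniform_mean K g.
Proof.
move=> cg; rewrite /uniform_mean; congr fine.
have mS : measurable_fun setT S by exact: continuous_measurable_rV.
transitivity (\int[pushforward (uniform affine_preimage) S]_x (g x)%:E)%E; last first.
  apply: (@eq_measure_integral _ _ _ _ (uniform K)
    (measure_function_pushforward__canonical__measure_function_Measure (uniform
      affine_preimage) mS)).
  move=> A mA _; rewrite -[LHS]/(uniform affine_preimage (S @^-1` A)).
  rewrite (uniformE volume_affine_preimage); apply: etrans (esym (uniformE K1 A)).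
  by apply: (volume_S (A := A `&` K)); apply: measurableI => //; exact: measurable_convex_body.
rewrite [RHS](@integral_pushforward _ _ _ _ R _ mS (uniform affine_preimage) setT (EFin \o
  g))//.
- exact: continuous_measurable_EFin.
- rewrite preimage_setT; apply: (uniform_integrable volume_affine_preimage (g := g \o S)).
  by move=> y; apply: continuous_comp; [exact: continuous_S|exact: cg].
Qed.

Hypothesis b_bary : b = barycenter K.

(** The vector for which the [i]-th coordinate of [y] is the scalar product of [S y - b] with [W i];
    moments of the preimage thereby become moments of linear functionals on [K]. *)
Let W (i : 'I_d) : 'rV[R]_d := row i (invmx T)^T.

Let coordE i (y : 'rV[R]_d) : coord i y = dotv (S y) (W i) - dotv b (W i).
Proof.
have dW x : dotv x (W i) = (x *m invmx T) 0 i.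
  by rewrite mxE; apply: eq_bigr => j _; rewrite /W !mxE.
rewrite !dW -[coord i y]/(y 0 i) -{1}(S'K y) /S' mulmxBl [LHS]mxE; congr (_ + _).
by rewrite mxE.
Qed.

Let continuous_shifted_dotv i : continuous (fun x : 'rV[R]_d => dotv x (W i) - dotv b (W i)).
Proof.
move=> x; apply: (@continuousB _ _ _ (fun x => dotv x (W i)) (cst (dotv b (W i)))).
  exact: continuous_dotv.
exact: cst_continuous.
Qed.

Lemma barycenter_affine_preimage : barycenter affine_preimage = 0.
Proof.
apply/rowP => i; rewrite !mxE.
have -> : coord i = (fun y => (fun x => dotv x (W i) - dotv b (W i)) (y *m T + b)).
  by apply/funext => y; rewrite coordE.
rewrite (uniform_mean_affine_preimage (@continuous_shifted_dotv i)).
have cc : continuous (fun _ : 'rV[R]_d => - dotv b (W i)) by move=> x; exact: cst_continuous.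
apply: (etrans (uniform_meanD K1 (@continuous_dotv _ _ (W i)) cc)).
rewrite uniform_mean_cst uniform_mean_dotv// b_bary /dotv.
apply/eqP; rewrite subr_eq0; apply/eqP; apply: eq_bigr => j _.
by rewrite mulrC; congr (_ * _); rewrite [barycenter K _ _]mxE.
Qed.

Lemma covariance_mx_affine_preimage :
  covariance_mx affine_preimage = (invmx T)^T *m covariance_mx K *m invmx T.
Proof.
apply/matrixP => i j; rewrite [LHS]mxE barycenter_affine_preimage.
transitivity (uniform_mean K (fun x =>
    (dotv x (W i) - dotv b (W i)) * (dotv x (W j) - dotv b (W j)))).
  rewrite -uniform_mean_affine_preimage; last first.
    by move=> x; exact: (continuousM (@continuous_shifted_dotv i x) (@continuous_shifted_dotv j
      x)).
  by congr uniform_mean; apply/funext => y; rewrite !coordE ![(0 : 'rV[R]_d) _ _]mxE !subr0.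
rewrite b_bary (covariance_dotv K1) /W -!row_mul.
by rewrite !mxE; apply: eq_bigr => k _; rewrite !mxE.
Qed.

End affine_image.

(** Write the covariance matrix as [M M^T]. The map with matrix [M^T / L] has determinant 1 when [L]
    is the root of order [n + 1] of [det M], and pulling back by it turns the covariance into [L^2]
    times the identity. *)
Lemma isotropic_position (R : realType) n (K : convex_body R n.+1) : volume K = 1%E ->
  exists (K' : convex_body R n.+1) (L : R), [/\ volume K' = 1%E, 0 < L,
    barycenter K' = 0, covariance_mx K' = (L ^+ 2)%:M &
    exists2 theta, sphere n.+1 theta & qform (covariance_mx K) theta <= L ^+ 2].
Proof.
move=> K1.
have [M [m [AE m0 detM hM]]] := cholesky (covariance_mx_tr K) (covariance_mx_pd K1).
have detM0 : 0 < \det M by rewrite detM prodr_gt0.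
pose L := \det M `^ n.+1%:R^-1.
have L0 : 0 < L by rewrite powR_gt0.
have LE : L ^+ n.+1 = \det M.
  by rewrite -powR_mulrn ?ltW// /L -powRrM mulVf ?pnatr_eq0// powRr1// ltW.
have M_unit : M \in unitmx by rewrite unitmxE unitfE gt_eqF.
have MT_unit : M^T \in unitmx by rewrite unitmx_tr.
have L_unit : L^-1 \is a GRing.unit by rewrite unitrV unitfE gt_eqF.
pose T : 'M[R]_n.+1 := L^-1 *: M^T.
have T_unit : T \in unitmx by rewrite /T unitmxZ.
have detT : `|\det T| = 1.
  by rewrite /T detZ det_tr exprVn LE mulVf ?normr1// gt_eqF.
have invT : invmx T = L *: invmx M^T by rewrite /T invmxZ// invrK.
exists (affine_preimage K (barycenter K) T_unit), L; split => //.
- exact: volume_affine_preimage.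
- exact: barycenter_affine_preimage.
- rewrite covariance_mx_affine_preimage// invT [(_ *: _)^T]linearZ/= trmx_inv trmxK AE.
  rewrite -!scalemxAl -scalemxAr scalerA !mulmxA mulVmx// mul1mx mulmxV//.
  by rewrite scalemx1 expr2.
(* The product of the [n + 1] diagonal entries is [L] to the power [n + 1], so the least entry is at
   most [L]; its index supplies the direction of small variance. *)
have [i mi] : exists i, forall j, m i <= m j.
  have := @arg_minP _ _ _ (ord0 : 'I_n.+1) xpredT m isT.
  by case=> i _ h; exists i => j; exact: h.
have miL : m i <= L.
  rewrite -(@ler_pXn2r _ n.+1)// ?nnegrE ?(ltW L0) ?(ltW (m0 i))//.
  rewrite LE detM -[n.+1 in X in X <= _]card_ord -prodr_const.
  by apply: ler_prod => j _; rewrite mi ltW.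
have [theta theta0 h] := hM i.
exists ((norm2 theta)^-1 *: theta); first exact: normalize_sphere.
have d0 := dotv_gt0 theta0.
rewrite qformZ AE qform_mul_tr exprVn sqr_sqrtr ?dotv_ge0// mulrC ler_pdivrMr//.
apply: (le_trans h); by rewrite ler_wpM2r ?dotv_ge0// ler_sqr ?nnegrE ?(ltW L0) ?(ltW (m0 i)).
Qed.

(** * The equivalences *)

Definition hyperplane_conjecture (R : realType) : Prop := exists2 c : R, 0 < c &
  forall (d : nat) (K : convex_body R d), (0 < d)%N -> volume K = 1%E ->
    exists theta t, sphere d theta /\
      (c%:E <= hyperplane_volume theta t (hyperplane theta t `&` K))%E.

Definition floating_bodies_in_ball (R : realType) (delta r : R) : Prop :=
  forall (d : nat) (K : convex_body R d), (0 < d)%N ->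
    isotropic K -> volume K = 1%E -> floating_body delta K `<=` ball2 0 r.

Lemma hyperplane_conjecture_floating (R : realType) (delta : R) :
  hyperplane_conjecture R -> 0 < delta ->
  exists2 r, 0 < r & floating_bodies_in_ball delta r.
Proof.
move=> [c c0 hc] d0; exists (16 / c / Num.sqrt delta).
  by rewrite !divr_gt0// sqrtr_gt0.
case=> // n K _ Kiso K1; have [bary0 [L L0 covL]] := (isotropicP K1).1 Kiso.
have [theta [t [theta1 ht]]] := hc _ K isT K1.
have Lle := isotropic_constant_le K1 L0 bary0 covL theta1 c0 ht.
apply: subset_trans (floating_body_sub_ball K1 L0 bary0 covL d0) _ => x /=.
rewrite /ball2/= => /le_trans; apply.
by rewrite ler_wpM2r// invr_ge0 sqrtr_ge0.
Qed.

Lemma floating_hyperplane_conjecture (R : realType) (delta r : R) :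
  0 < delta -> delta < expR (- 1) ->
  floating_bodies_in_ball delta r -> hyperplane_conjecture R.
Proof.
move=> d0 d1 hr; pose k := - (1 + ln delta) * (delta / 64).
have k0 : 0 < k.
  have : ln delta < ln (expR (- 1)) by rewrite ltr_ln ?posrE ?expR_gt0.
  by rewrite expRK => h; rewrite mulr_gt0 ?divr_gt0//; lra.
(* An upper bound for the isotropic constants; the maximum with 1 keeps it positive whatever the
   sign of [r]. *)
pose C := Num.max 1 (r / k).
have C0 : 0 < C by rewrite lt_max ltr01.
exists (8 * C)^-1; first by rewrite invr_gt0 mulr_gt0.
case=> // n K _ K1.
have [K' [L [K'1 L0 bary0 covL [theta theta1 hq]]]] := isotropic_position K1.
have Kiso : isotropic K' by apply/(isotropicP K'1); split => //; exists L.
have := isotropic_constant_le_floating K'1 L0 bary0 covL d0 d1 (hr _ K' isT Kiso K'1).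
rewrite -/k => kL.
have LC : L <= C by rewrite le_max ler_pdivlMr// mulrC kL orbT.
have [|t ht] := section_ge_of_variance_le K1 theta1 C0.
  apply: (le_trans hq); rewrite ler_sqr ?nnegrE ?(ltW L0) ?(ltW C0) //.
by exists theta, t.
Qed.

Theorem theorem1 (R : realType) :
  [<-> (* the hyperplane conjecture *)
       exists2 c : R, 0 < c &
         forall (d : nat) (K : convex_body R d), (0 < d)%N -> volume K = 1%E ->
           exists theta t, sphere d theta /\
             (c%:E <= hyperplane_volume theta t (hyperplane theta t `&` K))%E;
       (* Lambda_1 *)
       exists delta r : R, [/\ 0 < delta, delta < expR (- 1), 0 < r &
         forall (d : nat) (K : convex_body R d), (0 < d)%N ->
           isotropic K -> volume K = 1%E -> floating_body delta K `<=` ball2 0 r];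
       (* Lambda_2 *)
       forall delta : R, 0 < delta -> delta < expR (- 1) ->
         exists2 r : R, 0 < r &
           forall (d : nat) (K : convex_body R d), (0 < d)%N ->
             isotropic K -> volume K = 1%E -> floating_body delta K `<=` ball2 0 r].
Proof.
(* Any value in the open interval would do: it is the witness for the second statement and the
   instance taken from the third. *)
pose delta : R := expR (- 1) / 2.
have e0 : 0 < expR (- 1) :> R by exact: expR_gt0.
have d0 : 0 < delta by rewrite divr_gt0.
have d1 : delta < expR (- 1) by rewrite /delta; lra.
split=> [hc|].
  have [r r0 hr] := hyperplane_conjecture_floating hc d0.
  by exists delta, r.
(* Passing from the single parameter [e] to an arbitrary [e'] goes through the hyperplane
   conjecture. *)
split=> [[e [r [ep e1 r0 hr]]] e' e'0 _|h].
  exact: hyperplane_conjecture_floating (floating_hyperplane_conjecture ep e1 hr) e'0.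
have [r _ hr] := h delta d0 d1.
exact: floating_hyperplane_conjecture d0 d1 hr.
Qed.
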